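(* Let $r\ge 1$ and let $\lambda^1,\dots,\lambda^r$ be partitions. Then \[ \kappa(\lambda^1,\dots,\lambda^r)(\mathbf{x};q,t)=\sum_{\sigma:\lambda^{[r]}\to\mathbb{Z}_{>0}}\mathcal{I}_{G^{\sigma}_{\lambda^1,\dots,\lambda^r}}(q)\,t^{\mathrm{maj}(\sigma)}\,\mathbf{x}^{\sigma}, \] where the sum runs over all fillings $\sigma$ of the Young diagram $\lambda^{[r]}=\lambda^1\oplus\cdots\oplus\lambda^r$ by positive integers and $\mathbf{x}^\sigma=\prod_{\square\in\lambda^{[r]}}x_{\sigma(\square)}$.
   Context: Diagrams. A partition $\lambda=(\lambda_1\ge\lambda_2\ge\dots\ge\lambda_l>0)$ is identified with its Young diagram $\{(i,j):1\le j\le l,\ 1\le i\le\lambda_j\}$ (French convention: $i$ is the column, $j$ the row, row $1$ at the bottom); $\lambda^t$ is the conjugate partition. For a box $\square=(i,j)$ its leg length is $\ell_\lambda(\square)=\lambda^t_i-j$. For partitions $\mu,\nu$, $\mu\oplus\nu=(\mu_1+\nu_1,\mu_2+\nu_2,\dots)$; for $\emptyset\neq B\subseteq[r]$ put $\lambda^B=\bigoplus_{b\in B}\lambda^b$. Statistics of a filling $\sigma:\lambda\to\mathbb{Z}_{>0}$. A box $\square=(i,j+1)$ is a descent if $\sigma(\square)>\sigma((i,j))$; $\mathrm{Des}(\sigma)$ is the set of such boxes and $\mathrm{maj}(\sigma)=\sum_{\square\in\mathrm{Des}(\sigma)}(\ell_\lambda(\square)+1)$. An inversion pair is a pair of boxes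 $(\square_1,\square_2)$ in the same row with $\square_1$ strictly to the left of $\square_2$, such that, with $\square_3$ the box directly below $\square_1$, one of the following holds: $\sigma(\square_1)\le\sigma(\square_3)<\sigma(\square_2)$; or $\sigma(\square_3)<\sigma(\square_2)<\sigma(\square_1)$; or $\sigma(\square_2)<\sigma(\square_1)\le\sigma(\square_3)$ (if $\square_1,\square_2$ lie in row 1, $\sigma(\square_3)$ is taken smaller than all entries). $\mathrm{inv}(\sigma)$ is the number of inversion pairs. Macdonald polynomials (modified, defined by the Haglund formula): $\tilde H_\lambda(\mathbf{x};q,t)=\sum_{\sigma:\lambda\to\mathbb{Z}_{>0}}q^{\mathrm{inv}(\sigma)}t^{\mathrm{maj}(\sigma)}\mathbf{x}^\sigma$. Macdonald cumulant: $\kappa(\lambda^1,\dots,\lambda^r)=(q-1)^{1-r}\sum_{\pi}(-1)^{\#\pi-1}(\#\pi-1)!\prod_{B\in\pi}\tilde H_{\lambda^B}$, the sum over all set partitions $\pi$ of $[r]=\{1,\dots,r\}$ into nonempty blocks. Coloring. The diagram $\lambda^{[r]}$ is obtained by taking all columns of $\lambda^1,\dots,\lambda^r$ and sorting them in weakly decreasing order of length, where among columns of equal length those of $\lambda^b$ come before those of $\lambda^{b'}$ whenever $b<b'$ (columns of a single $\lambda^b$ keep their order). A column (and each of its boxes) of $\lambda^{[r]}$ is colored $b$ if it comes from $\lambda^b$. The multigraph $G^\sigma_{\lambda^1,\dots,\lambda^r}$ for a filling $\sigma$ of $\lambda^{[r]}$: vertex set $[r]$; for $i,j\in[r]$ (not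 necessarily distinct) the number of edges between $i$ and $j$ equals the number of inversion pairs $(\square_1,\square_2)$ of $\sigma$ whose set of colors $\{\mathrm{color}(\square_1),\mathrm{color}(\square_2)\}$ equals $\{i,j\}$ (pairs with both boxes colored $i$ give loops at $i$). $G$-inversion polynomial. For a multigraph $G$ (loops allowed) on vertex set $[r]$, let $e_{i,j}(G)$ be the number of edges joining $i\ne j$, let $\tilde G$ be the simple graph on $[r]$ with $i\sim j$ iff $e_{i,j}(G)>0$, and root all trees at vertex $1$. For a spanning tree $T$ of $\tilde G$ (with ancestor/descendant/parent relative to the root), a $\kappa$-inversion is a pair $(i,j)$ of non-root vertices with $i$ an ancestor of $j$, $i>j$, and $e_{\mathrm{parent}(i),j}(G)>0$; set $\kappa(T)=\sum_{(i,j)\ \kappa\text{-inversion}}e_{\mathrm{parent}(i),j}(G)$. Then $\mathcal{I}_G(q)=q^{\#\text{loops of }G}\sum_{T}q^{\kappa(T)}\prod_{\{i,j\}\in E(T)}[e_{i,j}(G)]_q$, the sum over spanning trees of $\tilde G$, with $[n]_q=1+q+\dots+q^{n-1}$ (in particular $\mathcal{I}_G=0$ if $G$ is disconnected). *)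

(* Defs.v *)
From mathcomp Require Import all_boot all_order all_algebra.
From mathcomp Require Import finmap multiset mpoly.

Set Implicit Arguments.
Unset Strict Implicit.
Unset Printing Implicit Defensive.

Import GRing.Theory.

Local Open Scope nat_scope.
Local Open Scope fset_scope.
Local Open Scope mset_scope.

Definition is_partition (la : seq nat) := sorted geq la && (0 \notin la).

(* Boxes are pairs (column, row), both counted from 1; row 1 is the bottom. *)
Definition diagram (la : seq nat) : {fset nat * nat} :=
  [fset p in [seq (i, j) | j <- iota 1 (size la), i <- iota 1 (nth 0 la j.-1)]].

Lemma in_diagram (la : seq nat) (i j : nat) :
  ((i, j) \in diagram la) =
  [&& 0 < j, j <= size la, 0 < i & i <= nth 0 la j.-1].
Proof.
rewrite !inE /=; apply/allpairsPdep/idP => [[y [x [hy hx [-> ->]]]]|/and4P[a b c d]].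
  move: hy hx; rewrite !mem_iota !add1n !ltnS => /andP[-> ->] /andP[-> ->] //.
by exists j, i; rewrite !mem_iota !add1n !ltnS a b c d.
Qed.

Definition conj_part (la : seq nat) : seq nat :=
  mkseq (fun i => count (leq i.+1) la) (head 0 la).

Definition leg (la : seq nat) (p : nat * nat) : nat :=
  nth 0 (conj_part la) p.1.-1 - p.2.

Definition opluspart (r : nat) (la : 'I_r -> seq nat) (B : {set 'I_r}) : seq nat :=
  mkseq (fun j => \sum_(b in B) nth 0 (la b) j) (\max_(b in B) size (la b)).

(* Positive integers, serving as entries of fillings and as indices of the
   variables x_1, x_2, ... *)
Notation posint := {n : nat | 0 < n}.

Definition filling (la : seq nat) := {ffun diagram la -> posint}.

(* The value 0 outside the diagram implements the convention that the missing
   box under a box of row 1 has an entry smaller than all the others. *)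
Definition entry (la : seq nat) (s : filling la) (p : nat * nat) : nat :=
  oapp (fun b : diagram la => val (s b)) 0 (insub p).

Definition below (p : nat * nat) : nat * nat := (p.1, p.2.-1).

Section Statistics.
Variables (la : seq nat) (s : filling la).

Definition Des : {set diagram la} :=
  [set b | (1 < (val b).2) && (entry s (below (val b)) < entry s (val b))].

Definition maj : nat := \sum_(b in Des) (leg la (val b)).+1.

Definition is_inversion (b1 b2 : diagram la) : bool :=
  let s1 := entry s (val b1) in
  let s2 := entry s (val b2) in
  let s3 := entry s (below (val b1)) in
  [&& (val b1).2 == (val b2).2, (val b1).1 < (val b2).1 &
      [|| s1 <= s3 < s2, s3 < s2 < s1 | s2 < s1 <= s3]].

Definition Inv : {set diagram la * diagram la} :=
  [set bb | is_inversion bb.1 bb.2].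

Definition inv : nat := #|Inv|.

End Statistics.

(* A monomial in x_1, x_2, ... is the multiset of the indices of its variables. *)
Notation monomial := {mset posint}.

Definition xmon (la : seq nat) (s : filling la) : monomial :=
  seq_mset [seq s b | b <- enum {: diagram la}].

Definition fillings (la : seq nat) (m : monomial) : {fset filling la} :=
  [fset s in [seq [ffun b => val (u b)] |
      u : {ffun diagram la -> finsupp m} <- enum {: {ffun diagram la -> finsupp m}}] |
    xmon s == m].

Lemma mem_fillings (la : seq nat) (m : monomial) (s : filling la) :
  (s \in fillings la m) = (xmon s == m).
Proof.
rewrite !inE /=; case: eqP => [e|]; last by rewrite andbF.
rewrite andbT.
have h b : s b \in finsupp m.
  rewrite -e multiset.msuppE (perm_mem (perm_eq_seq_mset _)).
  by apply: map_f; rewrite mem_enum.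
apply/mapP; exists [ffun b => [` h b]]; first by rewrite mem_enum.
by apply/ffunP => b; rewrite !ffunE.
Qed.

Definition submonomials (m : monomial) : {fset monomial} :=
  [fset m' in [seq seq_mset (mask (val u) (enum_mset m)) |
      u : (size (enum_mset m)).-tuple bool
        <- enum {: (size (enum_mset m)).-tuple bool}]].

Lemma mem_submonomials (m m' : monomial) :
  (m' \in submonomials m) = (m' `<=` m).
Proof.
have countE (a : monomial) x : count_mem x (enum_mset a) = a x.
  exact: count_mem_mset.
rewrite !inE /=; apply/mapP/idP => [[u _ ->]|le].
  apply/msubsetP => x; rewrite mset_seqE -countE.
  elim: (enum_mset m) (val u) => [|y l IH] [|[] v] //=.
    by rewrite leq_add2l.
  exact: leq_trans (IH v) (leq_addl _ _).
have /count_subseqP[l /subseqP[u su el] pl] : forall x : posint,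
    count_mem x (enum_mset m') <= count_mem x (enum_mset m).
  by move=> x; rewrite !countE; apply: (msubsetP le).
exists (Tuple (introT eqP su)); first by rewrite mem_enum.
by rewrite /= -el -[LHS]seq_mset_id; apply/eq_seq_msetP.
Qed.

(* Formal power series in x_1, x_2, ...: a family of coefficients. *)
Definition series (K : Type) := monomial -> K.

Section Series.
Local Open Scope ring_scope.
Variable K : comNzRingType.

Definition sone : series K := fun m => (m == mset0)%:R.

Definition smul (f g : series K) : series K :=
  fun m => \sum_(m' <- submonomials m) f m' * g (m `\` m').

(* sum of c s * x^s over all fillings s of la *)
Definition filling_sum (la : seq nat) (c : filling la -> K) : series K :=
  fun m => \sum_(s <- fillings la m) c s.

Definition Htilde (q t : K) (la : seq nat) : series K :=
  filling_sum (fun s : filling la => q ^+ inv s * t ^+ maj s).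

End Series.

Definition cumulant (K : fieldType) (q t : K) (r : nat) (la : 'I_r -> seq nat) :
    series K := fun m =>
  ((q - 1) ^ (1 - r%:Z) *
   \sum_(P : {set {set 'I_r}} | partition P [set: 'I_r])
     (-1) ^+ #|P|.-1 * (#|P|.-1)`!%:R *
     (\big[@smul K/@sone K]_(B in P) Htilde q t (opluspart la B)) m)%R.

(* The columns of lambda^[r], each recorded as (length, color). *)
Definition column_le (r : nat) (c d : nat * 'I_r) : bool :=
  (d.1 < c.1) || ((c.1 == d.1) && (c.2 <= d.2)).

Definition columns (r : nat) (la : 'I_r -> seq nat) : seq (nat * 'I_r) :=
  sort (@column_le r) [seq (h, b) | b <- enum 'I_r, h <- conj_part (la b)].

Definition color (r : nat) (la : 'I_r -> seq nat) (p : nat * nat) : option 'I_r :=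
  omap snd (onth (columns la) p.1.-1).

(* A multigraph on 'I_r is given by its edge multiplicities; e i i counts the
   loops at i. *)
Definition multigraph (r : nat) := 'I_r -> 'I_r -> nat.

Definition Ggraph (r : nat) (la : 'I_r -> seq nat)
    (s : filling (opluspart la setT)) : multigraph r := fun i j =>
  #|[set bb in Inv s |
      [set color la (val bb.1); color la (val bb.2)] == [set Some i; Some j]]|.

Section Trees.
Variable r : nat.
Implicit Types (e : multigraph r) (T : {set {set 'I_r}}) (i j p root : 'I_r).

Definition simple_edges e : {set {set 'I_r}} :=
  [set [set ij.1; ij.2] | ij : 'I_r * 'I_r & (ij.1 != ij.2) && (0 < e ij.1 ij.2)].

Definition adj T : rel 'I_r := fun i j => [set i; j] \in T.

Definition connected T : bool := [forall i, forall j, connect (adj T) i j].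

(* The bound on the length k only serves decidability, see acyclicP. *)
Definition acyclic T : bool :=
  [forall k : 'I_r.+1, forall c : k.-tuple 'I_r,
     (2 < k) ==> ~~ ucycleb (adj T) c].

Lemma acyclicP T :
  reflect (forall c : seq 'I_r, ucycle (adj T) c -> size c <= 2) (acyclic T).
Proof.
apply: (iffP 'forall_forallP) => [h c /andP[cc uc]|h k c].
  have sc : size c < r.+1 by rewrite ltnS -(card_uniqP uc) -[leqRHS]card_ord max_card.
  have := h (Ordinal sc) (in_tuple c).
  by rewrite /ucycleb cc uc implybF -leqNgt.
apply/implyP => k2; apply/negP => cc; have := h c cc.
by rewrite size_tuple leqNgt k2.
Qed.

Definition spanning_tree e T : bool :=
  [&& T \subset simple_edges e, connected T & acyclic T].

(* i lies on the simple path from root to j, see ancestorP; in particular a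
   vertex is an ancestor of itself. *)
Definition ancestor T root i j : bool :=
  [exists k : 'I_r, exists c : k.-tuple 'I_r,
     [&& path (adj T) root c, uniq (root :: c), last root c == j &
         i \in root :: c]].

Lemma ancestorP T root i j :
  reflect (exists c : seq 'I_r,
    [/\ path (adj T) root c, uniq (root :: c), last root c = j & i \in root :: c])
    (ancestor T root i j).
Proof.
apply: (iffP existsP) => [[k /existsP[c /and4P[p u /eqP l m]]]|[c [p u l m]]].
  by exists c.
have sc : size c < r.
  by have := max_card (mem (root :: c)); rewrite (card_uniqP u) card_ord.
exists (Ordinal sc); apply/existsP; exists (in_tuple c).
by rewrite /= p l eqxx m; move: u => /= ->.
Qed.

(* junk value i when i is the root *)
Definition parent T root i : 'I_r :=
  odflt i [pick p | [&& p != i, adj T p i & ancestor T root p i]].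

Definition kappa_inversion e T root i j : bool :=
  [&& i != root, j != root, ancestor T root i j, j < i &
      0 < e (parent T root i) j].

Definition kappa_stat e T root : nat :=
  \sum_(ij : 'I_r * 'I_r | kappa_inversion e T root ij.1 ij.2)
    e (parent T root ij.1) ij.2.

Definition loops e : nat := \sum_i e i i.

Local Open Scope ring_scope.

Definition qint (K : comNzRingType) (q : K) (n : nat) : K := \sum_(k < n) q ^+ k.

Definition Ginv_poly (K : comNzRingType) (q : K) root e : K :=
  q ^+ loops e *
  \sum_(T : {set {set 'I_r}} | spanning_tree e T)
    q ^+ kappa_stat e T root *
    \prod_(ij : 'I_r * 'I_r | (ij.1 < ij.2)%N && ([set ij.1; ij.2] \in T))
       qint q (e ij.1 ij.2).

End Trees.

(* The field Q(q, t). *)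
Notation Qqt := {fraction {mpoly rat[2]}}.

Definition qvar : Qqt := tofrac (mpolyX rat U_(ord0)%MM).
Definition tvar : Qqt := tofrac (mpolyX rat U_(ord_max)%MM).

(* Main.v *)
Require Import Defs.
From mathcomp Require Import all_boot all_order all_algebra.
From mathcomp Require Import finmap multiset mpoly.
Local Open Scope ring_scope.

(** Descents and inversion pairs of a filling only involve one or two columns,
    so a product of the H over the blocks of a set partition is a sum over
    fillings [s] of the whole diagram, with [q] raised to the number of edges
    of the multigraph of [s] that lie inside a block. The theorem thus reduces
    to an identity for one multigraph [e]: the cumulant of [S |-> q^(edges
    inside S)] is [(q - 1)^(r - 1)] times the sum over spanning trees.
    Both sides satisfy the same recursion. Delete the root [v] and let [B] be
    the component of a fixed vertex [w]: the cumulant factors as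
    [K(B) (q^e(v,B) - 1) K(S \ B)], whereas for trees [B] is the subtree of the
    child [i] of [v] above [w], contributing
    [q^(sum_(j in B, j < i) e(v,j)) (q^e(v,i) - 1)]; the sum of these factors
    over [i] in [B] telescopes, because by induction the tree sum over [B] does
    not depend on its root [i]. *)

Set Implicit Arguments.
Unset Strict Implicit.
Unset Printing Implicit Defensive.
Import GRing.Theory.

(** * Cumulants of set functions *)

Section SetCumulant.
Variables (T : finType) (R : comNzRingType) (Q : {set T} -> R).
Implicit Types (A B D S : {set T}) (P : {set {set T}}) (v w : T).

(** Multiplication by the (r - 1)st power of q - 1 gives each of the r - 1 edges of a tree one
    factor q - 1, and [(q - 1) * qint q n = q ^+ n - 1]. The graph identity then has no denominators
    and holds over any commutative ring. Moreover a non-edge gets weight q^0 - 1 = 0, so trees can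
    be summed over all parent functions without mention of the graph; only afterwards are they
    matched with spanning trees given as edge sets. No Moebius inversion is used for cumulants: the
    relation Q(S) = sum of K(B) Q(S \ B), over the B in S containing a fixed v, determines K,
    because its term B = S is K(S) itself. For fillings the obstacle is that the diagrams of the
    various lambda^B are different types. All fillings therefore become functions on the boxes of
    lambda^[r] that vanish outside the colors of B, and gluing blocks becomes pointwise addition. *)

Definition cumulant_coef (n : nat) : R := (-1) ^+ n.-1 * (n.-1)`!%:R.

Definition set_cumulant S : R :=
  \sum_(P : {set {set T}} | partition P S)
    cumulant_coef #|P| * \prod_(B in P) Q B.

Lemma cumulant_coef_rec n :
  cumulant_coef n.+2 = - (n.+1%:R * cumulant_coef n.+1).
Proof.
by rewrite /cumulant_coef /= exprS factS natrM mulN1r mulNr mulrCA.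
Qed.

Lemma card_blocks_not_containing P S v : partition P S -> v \in S ->
  #|[set D in P | v \notin D]| = #|P|.-1.
Proof.
move=> pP vS; have [cP tP n0] := and3P pP.
have vc : v \in cover P by rewrite (eqP cP).
rewrite [in RHS](cardsD1 (pblock P v)) pblock_mem //=.
apply: eq_card => D; rewrite !inE andbC; case DP: (D \in P); last by rewrite !andbF.
rewrite !andbT; congr negb; apply/idP/eqP => [vD|->]; last by rewrite mem_pblock.
by rewrite (def_pblock tP DP vD).
Qed.

Lemma partition_one_block P S v : partition P S -> v \in S ->
  (#|P| == 1)%N = (P == [set S]).
Proof.
move=> pP vS; apply/cards1P/eqP => [[B PB]|->]; last by exists S.
have [/eqP cP _ _] := and3P pP.
by rewrite PB /cover big_set1 in cP; rewrite PB cP.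
Qed.

(* Adding [S :\: B] to the blocks of a partition of [B] yields a partition of
   [S] with a marked block avoiding [v]; a partition with [n] blocks arises
   [n - 1] times. *)
Lemma set_cumulant_rec v S : Q set0 = 1 -> v \in S ->
  \sum_(B : {set T} | (v \in B) && (B \subset S)) set_cumulant B * Q (S :\: B) = Q S.
Proof.
move=> Q0 vS; rewrite (bigD1 S) /=; last by rewrite vS subxx.
rewrite setDv Q0 mulr1.
under eq_bigr => B _ do rewrite big_distrl /=.
rewrite pair_big_dep /=.
pose h (x : {set {set T}} * {set T}) := (S :\: x.2, x.1 :\ x.2).
pose h' (x : {set T} * {set {set T}}) := ((S :\: x.1) |: x.2, S :\: x.1).
rewrite (reindex_onto h h') /=; last first.
  move=> [B P] /=; rewrite /h /h' /= => /andP[/andP[/andP[vB BS] nBS] pP].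
  rewrite setDDr setDv set0U (setIidPr BS) setU1K //.
  apply/negP => DP; have := partitionS pP DP => sub.
  have := set0D (S :\: B); have [_ _ n0] := and3P pP.
  have e : S :\: B = set0.
    apply/eqP; rewrite -subset0; apply/subsetP => x xD.
    by have /subsetP/(_ x xD) := sub; move: xD; rewrite !inE => /andP[/negbTE->].
  by rewrite e (negbTE n0) in DP.
rewrite (eq_bigl (fun x : {set {set T}} * {set T} =>
    partition x.1 S && ((x.2 \in x.1) && (v \notin x.2)))); last first.
  move=> [P D] /=; rewrite /h' /h /= !inE vS andbT subsetDl andbT.
  rewrite setDDr setDv set0U xpair_eqE.
  apply/idP/idP => [/andP[/andP[/andP[vD nS] pP]] /andP[/eqP eP /eqP eD]|].
    have nD : D != set0 by apply: contraNneq nS => ->; rewrite setD0.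
    rewrite eD in eP; rewrite vD -eP setU11 !andbT.
    have eS : D :|: (S :\: D) = S by rewrite -{1}eD setID.
    rewrite -[X in partition _ X]eS.
    apply: partitionU1 => //.
    by rewrite -setI_eq0 setIDA setIC -setIDA setDv setI0.
  move=> /and3P[pP DP vD]; have DS := partitionS pP DP.
  rewrite vD (setIidPr DS) eqxx setD1K // eqxx !andbT /=.
  rewrite partitionD1 // andbT; apply/eqP => e.
  have n0 : D != set0 by have [_ _] := and3P pP; apply: contraNneq => <-.
  case/set0Pn: n0 => x xD; have : x \in S :\: D by rewrite e (subsetP DS).
  by rewrite inE xD.
rewrite [X in _ + X = _](_ : _ = \sum_(P : {set {set T}} | partition P S)
   \sum_(D : {set T} | (D \in P) && (v \notin D))
     cumulant_coef #|P :\ D| * \prod_(B in P :\ D) Q B * Q (S :\: (S :\: D)));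
  last by rewrite pair_big_dep.
(* Each partition of [S] now carries its own term, from [B = S], and those of its marked blocks. A
   single block cannot be marked and leaves [Q S]; for n >= 2 blocks the coefficients cancel, c(n) +
   (n - 1) c(n - 1) = 0. *)
rewrite -big_split /=.
rewrite (bigD1 [set S]) /=; last first.
  apply/and3P; split; first by rewrite /cover big_set1.
    by apply/trivIsetP => A B /set1P-> /set1P->; rewrite eqxx.
  by rewrite inE; apply/eqP => e; rewrite -e inE in vS.
rewrite [X in _ + X]big1 ?addr0.
  rewrite big_set1 [X in _ + X]big1 ?addr0 => [|D].
    by rewrite /cumulant_coef cards1 expr0 !mul1r.
  by rewrite inE => /andP[/eqP-> ]; rewrite vS.
move=> P /andP[pP nP].
have cP : (1 < #|P|)%N.
  rewrite ltn_neqAle eq_sym (partition_one_block pP vS) nP /= card_gt0.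
  apply/eqP => e; have [/eqP c _ _] := and3P pP.
  by move: vS; rewrite -c e /cover big_set0 inE.
rewrite [X in _ + X](eq_bigr (fun _ => cumulant_coef #|P|.-1 * \prod_(B in P) Q B)); last first.
  move=> D /andP[DP vD]; rewrite -mulrA; congr (_ * _).
    by rewrite [in RHS](cardsD1 D) DP.
  rewrite [in RHS](big_setD1 D) //= mulrC setDDr setDv set0U.
  by rewrite (setIidPr (partitionS pP DP)).
rewrite big_const_seq iter_addr addr0.
have -> : count (fun D => (D \in P) && (v \notin D)) (index_enum _) = #|P|.-1.
  rewrite -(card_blocks_not_containing pP vS) cardE size_filter.
  by rewrite /index_enum; case: index_enum_key; apply: eq_count => D; rewrite !inE.
move: cP; case: (#|P|) => [//|[//|n]] _ /=.
by rewrite cumulant_coef_rec mulNr -!mulrA mulr_natl addNr.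
Qed.

Hypothesis Q0 : Q set0 = 1.

Lemma set_cumulant1 v : Q [set v] = 1 -> set_cumulant [set v] = 1.
Proof.
move=> Qv; have := set_cumulant_rec Q0 (set11 v).
rewrite Qv => <-; rewrite (big_pred1 [set v]) => [|B].
  by rewrite setDv Q0 mulr1.
by rewrite -sub1set -eqEsubset eq_sym.
Qed.

(** For a graph, [X v B] is q raised to the number of edges between [v] and [B]. *)
Variable X : T -> {set T} -> R.
Hypothesis XU : forall v B D, [disjoint B & D] -> X v (B :|: D) = X v B * X v D.
Hypothesis QU : forall v B, v \notin B -> Q (v |: B) = X v B * Q B.

(* [B] plays the role of the component of [w] after the deletion of [v]. *)
Lemma set_cumulant_split v w S : v \in S -> w \in S -> w != v ->
  set_cumulant S = \sum_(B : {set T} | (w \in B) && (B \subset S :\ v))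
      set_cumulant B * (X v B - 1) * set_cumulant (S :\: B).
Proof.
have [n] := ubnP #|S|; elim: n S => // n IHn S leSn vS wS wv.
pose K := set_cumulant.
pose F A := \sum_(B : {set T} | (w \in B) && (B \subset A :\ v)) K B * (X v B - 1) * K (A :\: B).
(* Both sides are convolved with [Q]. By induction the terms with [A] smaller than [S] agree, so
   equality of the sums forces equality of the terms [A = S]. *)
suff eqF : \sum_(A : {set T} | [&& v \in A, A \subset S & w \in A]) F A * Q (S :\: A) =
           \sum_(A : {set T} | [&& v \in A, A \subset S & w \in A]) K A * Q (S :\: A).
  move: eqF; rewrite (bigD1 S) /= ?vS ?subxx // [in X in _ = X](bigD1 S) /= ?vS ?subxx //.
  rewrite setDv Q0 !mulr1 => eqF.
  apply/esym; apply: (addIr _ (etrans eqF _)); congr (_ + _).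
  apply: eq_bigr => A /andP[/and3P[vA AS wA] nAS]; congr (_ * _).
  apply: IHn => //; rewrite -ltnS; apply: leq_trans leSn.
  by rewrite ltnS; apply: proper_card; rewrite properEneq nAS.
have vwS : w \in S :\ v by rewrite !inE wv.
have recw := set_cumulant_rec Q0 wS.
have recwv := set_cumulant_rec Q0 vwS.
(* For fixed [B] the sets [A :\: B] run over the subsets of [S :\: B] that contain [v]; the
   recursion at [v] sums their cumulants to [Q (S :\: B)]. *)
have step : \sum_(A : {set T} | [&& v \in A, A \subset S & w \in A]) F A * Q (S :\: A) =
   \sum_(B : {set T} | (w \in B) && (B \subset S :\ v)) K B * (X v B - 1) * Q (S :\: B).
  under eq_bigr => A _ do rewrite big_distrl /=.
  rewrite (exchange_big_dep (fun B => (w \in B) && (B \subset S :\ v))) /=; last first.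
    move=> A B /and3P[_ AS _] /andP[-> BA] /=; exact: subset_trans BA (setSD _ AS).
  apply: eq_bigr => B /andP[wB BS].
  have vB : v \notin B by apply/negP => /(subsetP BS); rewrite !inE eqxx.
  have BS' : B \subset S := subset_trans BS (subsetDl _ _).
  have vSB : v \in S :\: B by rewrite inE vB.
  rewrite -(set_cumulant_rec Q0 vSB) big_distrr /=.
  rewrite (reindex_onto (fun A => A :|: B) (fun A => A :\: B)) /=; last first.
    move=> A /andP[_ /andP[_ BA]]; rewrite setUC -[RHS](setID A B).
    rewrite (setIidPr _) //; exact: subset_trans BA (subsetDl _ _).
  apply: eq_big => [A|A /andP[_ /eqP eA]].
    rewrite !inE (negbTE vB) orbF wB orbT andbT subUset BS' andbT /=.
    have -> : (B \subset (A :|: B) :\ v).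
      by rewrite subsetD subsetUr /= disjoint_sym disjoints1.
    rewrite andbT subsetD setDUl setDv setU0 -!andbA; congr [&& _, _ & _].
    exact: (sameP eqP setDidPl).
  by rewrite eA -mulrA setDDl setUC.
rewrite {}step.
under eq_bigr => B _ do rewrite mulrBr mulr1 mulrBl.
rewrite big_split /= sumrN.
(* The edges at [v] into [B] and into the rest combine to the factor [X v (S :\ v)], independent of
   [B]; what remains is the recursion at [w] inside [S :\ v]. *)
have -> : \sum_(B : {set T} | (w \in B) && (B \subset S :\ v)) K B * X v B * Q (S :\: B) = Q S.
  rewrite -[in RHS](setD1K vS) QU ?setD11 // -recwv big_distrr /=.
  apply: eq_bigr => B /andP[wB BS].
  have vB : v \notin B by apply/negP => /(subsetP BS); rewrite !inE eqxx.
  have -> : S :\: B = v |: (S :\ v :\: B).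
    rewrite -[in LHS](setD1K vS) setDUl; congr (_ :|: _).
    by apply/setDidPl; rewrite disjoints1.
  rewrite QU; last by rewrite !inE eqxx andbF.
  have -> : X v (S :\ v) = X v B * X v (S :\ v :\: B).
    rewrite -XU; last by rewrite -setI_eq0 setIDA setIC -setIDA setDv setI0.
    by rewrite -[in LHS](setID (S :\ v) B) (setIidPr BS).
  by rewrite [K B * X v B]mulrC mulrACA.
(* In the recursion at [w] inside [S], the sets without [v] are exactly those being subtracted. *)
rewrite -recw (bigID (fun A => v \in A)) /=.
rewrite [X in _ + X - _](eq_bigl (fun B => (w \in B) && (B \subset S :\ v))).
  rewrite addrK; apply: eq_bigl => A.
  by case: (v \in A); case: (w \in A); rewrite ?andbT ?andbF.
by move=> B; rewrite subsetD disjoint_sym disjoints1 andbA.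
Qed.

End SetCumulant.

(** * Reachability under iteration of a function *)

Lemma fconnect_iterP (T : finType) (f : T -> T) x y :
  reflect (exists n, iter n f x = y) (fconnect f x y).
Proof.
by apply: (iffP idP) => [/iter_findex <-|[n <-]]; [eexists | apply: fconnect_iter].
Qed.

Lemma fconnect_closed (T : finType) (f : T -> T) (D : pred T) x y :
  (forall z, D z -> D (f z)) -> D x -> fconnect f x y -> D y.
Proof. by move=> cl Dx /fconnect_iterP[n <-]; elim: n => //= n; apply: cl. Qed.

(** Transfers an orbit between a tree and its graft or pruning. The target [y] is exempt because the
    parent changed by these operations is that of the target, the root of the subtree. *)
Lemma fconnect_eq_until (T : finType) (f g : T -> T) (D : pred T) x y :
  (forall z, D z -> z != y -> D (f z) /\ g z = f z) -> D x ->
  fconnect f x y -> fconnect g x y.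
Proof.
move=> h Dx /fconnect_iterP[n]; elim: n x Dx => [|n IH] x Dx.
  by move=> <-; apply: connect0.
have [->|xy] := eqVneq x y; first by move=> _; apply: connect0.
have [Df gx] := h x Dx xy; rewrite iterSr => /(IH _ Df).
by rewrite -gx; apply: connect_trans (fconnect1 _ _).
Qed.

Lemma fconnect_fixed (T : finType) (f : T -> T) x y :
  f x = x -> fconnect f x y -> y = x.
Proof. by move=> fx /fconnect_iterP[n <-]; elim: n => //= n ->. Qed.

Lemma fconnect_step (T : finType) (f : T -> T) x y :
  x != y -> fconnect f x y -> fconnect f (f x) y.
Proof.
move=> xy /fconnect_iterP[[|n]]; first by move=> /= e; rewrite e eqxx in xy.
by rewrite iterSr => <-; apply: fconnect_iter.
Qed.

(** * Rooted trees as parent functions *)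

Section RootedTrees.
Variables (r : nat) (R : comNzRingType) (q : R) (e : multigraph r).
Local Notation V := 'I_r.
Implicit Types (f g : {ffun V -> V}) (S B : {set V}) (i j v w x : V).

(* A tree on [S] rooted at [v] is encoded by its parent function, extended by
   the identity outside [S] and at the root. *)
Definition rooted_tree S v f :=
  (f v == v) && [forall x, if x \in S then fconnect f x v else f x == x].

(** The share of the edge from [i] to its parent: the exponent collects the kappa-inversions with
    first entry [i], and the second factor is q - 1 times the q-number of the edge. Fixed points,
    that is the root and the vertices outside the tree, weigh 1. *)
Definition vertex_weight f i : R :=
  if f i == i then 1 else
  q ^+ (\sum_(j : V | (j < i)%N && fconnect f j i) e (f i) j) * (q ^+ e (f i) i - 1).

Definition tree_weight f : R := \prod_i vertex_weight f i.

Definition tree_sum S v : R := \sum_(f | rooted_tree S v f) tree_weight f.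

Lemma rooted_treeP S v f :
  reflect [/\ f v = v, forall x, x \in S -> fconnect f x v &
              forall x, x \notin S -> f x = x] (rooted_tree S v f).
Proof.
apply: (iffP andP) => [[/eqP fv /forallP h]|[-> h1 h2]]; split=> //.
- by move=> x xS; have := h x; rewrite xS.
- by move=> x xS; have := h x; rewrite (negbTE xS) => /eqP.
by apply/forallP => x; case: ifP => [/h1|/negbT/h2->].
Qed.

Lemma rooted_tree_stable S v f x :
  v \in S -> rooted_tree S v f -> x \in S -> f x \in S.
Proof.
move=> vS /rooted_treeP[fv con fix_] xS; apply: contraTT (vS) => fxS.
have ffx := fix_ _ fxS.
have [xv|xv] := eqVneq x v; first by rewrite -fv -{1}xv.
by rewrite (fconnect_fixed ffx (fconnect_step xv (con _ xS))).
Qed.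

(** Both are the last vertex before [v] on the orbit of [w]. *)
Lemma top_unique v w f i i' : f v = v ->
  f i = v -> i != v -> fconnect f w i -> f i' = v -> i' != v -> fconnect f w i' ->
  i = i'.
Proof.
move=> fv + + /fconnect_iterP[a ea] + + /fconnect_iterP[b eb].
wlog ab : a b i i' ea eb / (a <= b)%N.
  move=> W h1 h2 h3 h4; have [ab|/ltnW ba] := leqP a b; first exact: (W a b).
  by apply/esym; apply: (W b a).
move=> fi iv fi' i'v; move: eb.
rewrite -(subnK ab) iterD ea; case: (b - a)%N => // n.
rewrite iterSr fi => ni; case/eqP: i'v; rewrite -ni.
by elim: (n) => //= k ->.
Qed.

Lemma top_exists v w f : w != v -> fconnect f w v ->
  exists i, [/\ f i = v, i != v & fconnect f w i].
Proof.
move=> wv /fconnect_iterP[n]; elim: n w wv => [|n IH] w wv.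
  by move=> /= e0; rewrite e0 eqxx in wv.
rewrite iterSr; have [fw _|fwv] := eqVneq (f w) v.
  by exists w; split; rewrite ?connect0.
move=> /(IH _ fwv)[i [fi iv ci]]; exists i; split=> //.
exact: connect_trans (fconnect1 _ _) ci.
Qed.

(* The child of the root [v] on the path from [w] to [v]. *)
Definition top v w f : V :=
  odflt v [pick i | [&& f i == v, i != v & fconnect f w i]].

Lemma topP v w f : w != v -> fconnect f w v ->
  [/\ f (top v w f) = v, top v w f != v & fconnect f w (top v w f)].
Proof.
move=> wv /(top_exists wv)[i [fi iv ci]]; rewrite /top; case: pickP => [j|/(_ i)].
  by move=> /and3P[/eqP].
by rewrite fi eqxx iv ci.
Qed.

(** * Cutting off and grafting the subtree at a child of the root *)

Definition descendants f i := [set j | fconnect f j i].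

(** A tree on [B] with root [i] is hung below [v]. In [prune], the vertices lost by either part
    become fixed points, as the encoding of trees requires, and [i] becomes a root. *)
Definition graft B i v (ff : {ffun V -> V} * {ffun V -> V}) : {ffun V -> V} :=
  [ffun x => if x == i then v else if x \in B then ff.1 x else ff.2 x].

Definition prune B i f : {ffun V -> V} * {ffun V -> V} :=
  ([ffun x => if (x \in B) && (x != i) then f x else x],
   [ffun x => if x \in B then x else f x]).

Section Graft.
Variables (S B : {set V}) (i v w : V) (f1 f2 : {ffun V -> V}).
Hypotheses (vS : v \in S) (wv : w != v) (wB : w \in B) (BS : B \subset S :\ v).
Hypotheses (iB : i \in B) (t1 : rooted_tree B i f1) (t2 : rooted_tree (S :\: B) v f2).
Let f := graft B i v (f1, f2).

Let vB : v \notin B.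
Proof. by apply/negP => /(subsetP BS); rewrite !inE eqxx. Qed.

Let vSB : v \in S :\: B. Proof. by rewrite inE vB. Qed.

Let iv : i != v. Proof. by apply: contraNneq vB => <-. Qed.

Let fi : f i = v. Proof. by rewrite ffunE eqxx. Qed.

Let fB x : x \in B -> x != i -> f x = f1 x.
Proof. by move=> xB /negbTE xi; rewrite ffunE xi xB. Qed.

Let fC x : x \notin B -> f x = f2 x.
Proof.
move=> xB; rewrite ffunE (negbTE xB); case: eqP => // xi.
by rewrite xi iB in xB.
Qed.

Let fv : f v = v.
Proof. by rewrite fC //; have [] := rooted_treeP _ _ _ t2. Qed.

Let f1B x : x \in B -> f1 x \in B.
Proof. exact: rooted_tree_stable iB t1. Qed.

Let f2C x : x \notin B -> f2 x \notin B.
Proof.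
move=> xB; have [xS|xS] := boolP (x \in S :\: B).
  by have := rooted_tree_stable vSB t2 xS; rewrite inE => /andP[].
by have [_ _ /(_ x xS) ->] := rooted_treeP _ _ _ t2.
Qed.

Let connB x : x \in B -> fconnect f x i.
Proof.
move=> xB; have [_ /(_ x xB) + _] := rooted_treeP _ _ _ t1.
apply: (fconnect_eq_until (D := mem B)) => //= z zB zi; split; first exact: f1B.
exact: fB.
Qed.

Lemma graft_descendants : descendants f i = B.
Proof.
apply/setP => x; rewrite inE; apply/idP/idP => [|/connB//].
apply: contraTT => xB; apply/negP => xi.
have : i \notin B by apply: (fconnect_closed (D := fun z => z \notin B)) xB xi => z zB; rewrite fC // f2C.
by rewrite iB.
Qed.

Lemma graft_rooted : rooted_tree S v f.
Proof.
have [_ con2 fix2] := rooted_treeP _ _ _ t2.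
apply/rooted_treeP; split=> // x xS; last first.
  have xB : x \notin B.
    by apply: contraNN xS => /(subsetP BS); rewrite inE => /andP[].
  by rewrite fC // fix2 // inE negb_and xS orbT.
have [xB|xB] := boolP (x \in B).
  by rewrite -fi; apply: connect_trans (connB xB) (fconnect1 _ _).
have /con2 : x \in S :\: B by rewrite inE xB.
apply: (fconnect_eq_until (D := fun z => z \notin B)) => //= z zB zi.
by rewrite fC // f2C.
Qed.

Lemma graft_top : top v w f = i.
Proof.
have [_ /(_ w) con _] := rooted_treeP _ _ _ graft_rooted.
have [|h1 h2 h3] := topP wv (con _).
  by have /(subsetP BS) := wB; rewrite inE => /andP[].
by apply: (top_unique fv h1 h2 h3 fi iv); apply: connB.
Qed.

Lemma graftK : prune B i f = (f1, f2).
Proof.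
have [f1i _ fix1] := rooted_treeP _ _ _ t1.
have [_ _ fix2] := rooted_treeP _ _ _ t2.
rewrite /prune; congr (_, _); apply/ffunP => x; rewrite ffunE.
  case: ifP => [/andP[xB xi]|]; first exact: fB.
  by case: eqVneq => [->|] //; rewrite andbT => _ /negbT/fix1.
case: ifPn => [xB|/fC//]; rewrite fix2 //.
by rewrite inE xB.
Qed.

(** The descendants of [x] are the same in both trees: [i] is not among them, so no orbit on its way
    to [x] meets [i], the only vertex of [B] whose parent differs. *)
Lemma vertex_weight_graftB x : x \in B -> x != i -> vertex_weight f x = vertex_weight f1 x.
Proof.
move=> xB xi; rewrite /vertex_weight fB //; case: eqVneq => // f1x.
congr (q ^+ _ * _); apply: eq_bigl => j; congr andb.
have xv : x != v by apply: contraTneq xB => ->.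
have iNx : ~~ fconnect f i x.
  apply/negP => ix; have := fconnect_step _ ix; rewrite eq_sym xi fi => /(_ isT).
  by move/(fconnect_fixed fv)/eqP; rewrite (negbTE xv).
have iNx1 : ~~ fconnect f1 i x.
  have [f1i _ _] := rooted_treeP _ _ _ t1.
  by apply/negP => /(fconnect_fixed f1i)/eqP; rewrite (negbTE xi).
apply/idP/idP => jx.
  have jB : j \in B.
    apply: contraTT xB => jB; move: jx.
    apply: (fconnect_closed (D := fun z => z \notin B)) => // z zB.
    by rewrite fC // f2C.
  apply: (fconnect_eq_until (D := fun z => (z \in B) && fconnect f z x)) (jx); last first.
    by rewrite jB.
  move=> z /andP[zB zx] zNx; have zi : z != i by apply: contraNneq iNx => <-.
  by rewrite fB // f1B // -fB // fconnect_step.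
have jB : j \in B.
  apply: contraTT jx => jB; have [_ _ /(_ j jB) f1j] := rooted_treeP _ _ _ t1.
  by apply/negP => /(fconnect_fixed f1j) xj; rewrite -xj xB in jB.
apply: (fconnect_eq_until (D := fun z => (z \in B) && fconnect f1 z x)) (jx); last first.
  by rewrite jB.
move=> z /andP[zB zx] zNx; have zi : z != i by apply: contraNneq iNx1 => <-.
by rewrite fB // f1B // fconnect_step.
Qed.

(** Hanging [B] below [v] gives new descendants to [v] alone, and [v] is a fixed point of weight 1
    in both trees. *)
Lemma vertex_weight_graftC x : x \notin B -> vertex_weight f x = vertex_weight f2 x.
Proof.
move=> xB; rewrite /vertex_weight fC //; case: eqVneq => // f2x.
congr (q ^+ _ * _); apply: eq_bigl => j; congr andb.
have [f2v _ fix2] := rooted_treeP _ _ _ t2.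
have xv : x != v by apply: contraNneq f2x => ->; rewrite f2v.
have [jB|jB] := boolP (j \in B).
  apply/idP/idP => jx.
    have : (x \in B) || (x == v).
      move: jx; apply: (fconnect_closed (D := fun z => (z \in B) || (z == v))).
        move=> z /orP[zB|/eqP->]; last by rewrite fv eqxx orbT.
        have [->|zi] := eqVneq z i; first by rewrite fi eqxx orbT.
        by rewrite fB // f1B.
      by rewrite jB.
    by rewrite (negbTE xB) (negbTE xv).
  have f2j : f2 j = j by apply: fix2; rewrite inE jB.
  by rewrite (fconnect_fixed f2j jx) jB in xB.
apply/idP/idP; apply: (fconnect_eq_until (D := fun z => z \notin B)) => // z zB _.
  by rewrite fC // f2C.
by rewrite fC // f2C.
Qed.

Lemma tree_weight_graft : tree_weight f = tree_weight f1 *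
  (q ^+ (\sum_(j in B | (j < i)%N) e v j) * (q ^+ e v i - 1)) * tree_weight f2.
Proof.
have [f1i _ fix1] := rooted_treeP _ _ _ t1.
have [_ _ fix2] := rooted_treeP _ _ _ t2.
rewrite /tree_weight (bigID (mem B)) /= [X in _ * X = _](eq_bigr (vertex_weight f2)); last first.
  by move=> x; apply: vertex_weight_graftC.
rewrite [in RHS](bigID (mem B)) /= [X in _ * X * _ * _]big1 ?mulr1; last first.
  by move=> x /fix1 f1x; rewrite /vertex_weight f1x eqxx.
rewrite [X in _ = _ * X](bigID (mem B)) /= [X in _ = _ * (X * _)]big1 ?mul1r; last first.
  by move=> x xB; rewrite /vertex_weight fix2 ?eqxx // inE xB.
congr (_ * _); rewrite (bigD1 i) //= [in RHS](bigD1 i) //= mulrC.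
rewrite [vertex_weight f1 i]/vertex_weight f1i eqxx mul1r; congr (_ * _).
  by apply: eq_bigr => x /andP[xB xi]; apply: vertex_weight_graftB.
rewrite /vertex_weight fi eq_sym (negbTE iv); congr (q ^+ _ * _).
apply: eq_bigl => j; rewrite andbC; congr andb.
by have /setP/(_ j) := graft_descendants; rewrite inE.
Qed.

End Graft.

Section Prune.
Variables (S B : {set V}) (i v w : V) (f : {ffun V -> V}).
Hypotheses (vS : v \in S) (fS : rooted_tree S v f).
Hypotheses (fi : f i = v) (iv : i != v) (dB : descendants f i = B).

Let inB x : (x \in B) = fconnect f x i.
Proof. by rewrite -dB inE. Qed.

Let fv : f v = v. Proof. by have [] := rooted_treeP _ _ _ fS. Qed.

Lemma descendants_sub : B \subset S :\ v.
Proof.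
have [_ _ fix_] := rooted_treeP _ _ _ fS.
apply/subsetP => x; rewrite inB !inE => xi; apply/andP; split.
  by apply: contraTneq xi => ->; apply/negP => /(fconnect_fixed fv)/eqP; apply/negP.
apply: contraTT xi => xS; apply/negP => /(fconnect_fixed (fix_ _ xS)) ix.
by move: fi; rewrite ix fix_ // => xv; rewrite xv vS in xS.
Qed.

Lemma prune_rooted : rooted_tree B i (prune B i f).1 /\ rooted_tree (S :\: B) v (prune B i f).2.
Proof.
have [_ con fix_] := rooted_treeP _ _ _ fS.
have iB : i \in B by rewrite inB.
split; apply/rooted_treeP; split=> /=.
- by rewrite ffunE eqxx andbF.
- move=> x xB; have := xB; rewrite {1}inB.
  apply: (fconnect_eq_until (D := mem B)) => //= z zB zi.
  by rewrite ffunE zB zi !inB fconnect_step // -inB.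
- by move=> x /negbTE xB; rewrite ffunE xB.
- by rewrite ffunE fv if_same.
- move=> x; rewrite inE => /andP[xB /con].
  apply: (fconnect_eq_until (D := fun z => z \notin B)) => //= z zB zi.
  rewrite ffunE (negbTE zB); split=> //; apply: contraNN zB; rewrite !inB.
  exact: connect_trans (fconnect1 _ _).
- by move=> x; rewrite inE negb_and negbK ffunE; case: (x \in B) => //= /fix_.
Qed.

Lemma pruneK : graft B i v (prune B i f) = f.
Proof.
apply/ffunP => x; rewrite !ffunE; case: eqVneq => [->|xi]; first by rewrite fi.
by case: (x \in B).
Qed.

End Prune.

Lemma tree_sum_rec S v w : v \in S -> w \in S -> w != v ->
  tree_sum S v = \sum_(B : {set V} | (w \in B) && (B \subset S :\ v))
    (\sum_(i in B) tree_sum B i *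
       (q ^+ (\sum_(j in B | (j < i)%N) e v j) * (q ^+ e v i - 1))) *
    tree_sum (S :\: B) v.
Proof.
move=> vS wS wv.
rewrite /tree_sum (partition_big (fun f => (descendants f (top v w f), top v w f))
  (fun Bi : {set V} * V => ((w \in Bi.1) && (Bi.1 \subset S :\ v)) && (Bi.2 \in Bi.1))).
  rewrite [RHS](eq_bigr _ (fun B _ => big_distrl _ _ _)) /= [RHS]pair_big_dep /=.
  apply: eq_bigr => [[B i]] /= /andP[/andP[wB BS] iB].
  rewrite mulrAC big_distrlr /= pair_big_dep /= big_distrl /=.
  rewrite (reindex_onto (graft B i v) (prune B i)) /=; last first.
    move=> f /andP[fS /eqP[dB ti]].
    have [_ /(_ w wS) con _] := rooted_treeP _ _ _ fS.
    have [] := topP wv con; rewrite ti => fi iv _.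
    by apply: pruneK.
  apply: eq_big => [[f1 f2]|[f1 f2] /andP[/andP[fS /eqP[dB ti]] /eqP eP]] /=.
    (* [reindex_onto] adds the condition that pruning the graft returns the pair; through it,
       rootedness of the pruned parts becomes rootedness of [f1] and [f2]. *)
    apply/idP/idP => [/andP[/andP[fS /eqP[dB ti]] /eqP eP]|/andP[t1 t2]].
      have [_ /(_ w wS) con _] := rooted_treeP _ _ _ fS.
      have [] := topP wv con; rewrite ti => fi iv _; rewrite ti in dB.
      by have [] := prune_rooted fS dB; rewrite eP => -> ->.
    rewrite (graft_rooted vS BS iB t1 t2) (graft_top vS wv wB BS iB t1 t2).
    by rewrite (graft_descendants vS BS iB t1 t2) (graftK iB t1 t2) !eqxx.
  have [_ /(_ w wS) con _] := rooted_treeP _ _ _ fS.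
  have [] := topP wv con; rewrite ti => fi iv _; rewrite ti in dB.
  have [] := prune_rooted fS dB; rewrite eP => t1 t2.
  by rewrite (tree_weight_graft vS BS iB t1 t2) mulrAC.
move=> f fS /=.
have [_ /(_ w wS) con _] := rooted_treeP _ _ _ fS.
have [fi iv wi] := topP wv con.
by rewrite !inE wi connect0 andbT /=; apply: descendants_sub fS fi iv erefl.
Qed.

Lemma tree_sum1 v : tree_sum [set v] v = 1.
Proof.
rewrite /tree_sum (big_pred1 [ffun x => x]) => [|f].
  by rewrite /tree_weight big1 // => i _; rewrite /vertex_weight ffunE eqxx.
apply/rooted_treeP/eqP => [[fv _ fx]|->].
  apply/ffunP => x; rewrite ffunE; have [->//|xv] := eqVneq x v.
  by apply: fx; rewrite inE.
by split=> [|x /set1P->|x _]; rewrite ?ffunE ?connect0.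
Qed.

(** In increasing order of [i], the terms are differences of q raised to consecutive partial sums of
    [a]. Removing the largest index leaves the exponents of all other terms unchanged. *)
Lemma sum_expr_telescope (a : V -> nat) B :
  \sum_(i in B) (q ^+ (\sum_(j in B | (j < i)%N) a j) * (q ^+ a i - 1)) =
  q ^+ (\sum_(i in B) a i) - 1.
Proof.
have [n] := ubnP #|B|; elim: n B => // n IHn B.
have [-> _|[x0 x0B] cB] := set_0Vmem B; first by rewrite !big_set0 subrr.
pose m := [arg max_(i > x0 in B) (i : nat)].
have [mB maxm] : m \in B /\ forall j, j \in B -> (j <= m)%N.
  by rewrite /m; case: arg_maxnP.
rewrite (big_setD1 m) //= [in RHS](big_setD1 m) //= exprD.
have -> : (\sum_(j in B | (j < m)%N) a j = \sum_(i in B :\ m) a i)%N.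
  apply: eq_bigl => j; rewrite !inE andbC; case jB: (j \in B); rewrite ?andbF //.
  by rewrite !andbT ltn_neqAle maxm // andbT.
have -> : \sum_(i in B :\ m) q ^+ (\sum_(j in B | (j < i)%N) a j) * (q ^+ a i - 1) =
    \sum_(i in B :\ m) q ^+ (\sum_(j in B :\ m | (j < i)%N) a j) * (q ^+ a i - 1).
  apply: eq_bigr => i; rewrite !inE => /andP[_ iB]; congr (q ^+ _ * _).
  apply: eq_bigl => j; rewrite !inE; case: eqVneq => [->|] //=.
  by rewrite mB ltnNge maxm.
rewrite IHn; last by rewrite -ltnS; apply: leq_trans cB; rewrite ltnS [leqRHS](cardsD1 m) mB.
by rewrite mulrBr mulr1 mulrC addrA subrK.
Qed.

Definition inner_edges S := (\sum_(i in S) \sum_(j in S | (i < j)%N) e i j)%N.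

Hypothesis e_sym : forall i j, e i j = e j i.

Lemma inner_edgesU1 v B : v \notin B ->
  inner_edges (v |: B) = (\sum_(u in B) e v u + inner_edges B)%N.
Proof.
move=> vB; rewrite /inner_edges big_setU1 //=.
have -> : (\sum_(i in B) \sum_(j in v |: B | i < j) e i j =
    \sum_(i in B | i < v) e v i + \sum_(i in B) \sum_(j in B | i < j) e i j)%N.
  rewrite [X in (X + _)%N]big_mkcondr /= -big_split /=; apply: eq_bigr => i iB.
  rewrite big_mkcondr big_setU1 //= -big_mkcondr /=; congr addn.
  by rewrite e_sym.
rewrite addnA; congr addn; rewrite big_mkcondr big_setU1 //= ltnn add0n.
rewrite [X in (_ + X)%N]big_mkcondr -big_split; apply: eq_bigr => u uB /=.
by case: ltngtP; rewrite ?addn0 // => /ord_inj vu; rewrite vu uB in vB.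
Qed.

Theorem tree_sumE S v : v \in S ->
  tree_sum S v = set_cumulant (fun B => q ^+ inner_edges B) S.
Proof.
have [n] := ubnP #|S|; elim: n S v => // n IHn S v leSn vS.
have Q0 : q ^+ inner_edges set0 = 1 by rewrite /inner_edges big_set0.
have [S1|[w wSv]] := set_0Vmem (S :\ v).
  have -> : S = [set v] by rewrite -(setD1K vS) S1 setU0.
  rewrite tree_sum1 set_cumulant1 // /inner_edges big_set1 big1 // => j.
  by case/andP=> /set1P->; rewrite ltnn.
have [wv wS] : w != v /\ w \in S by move: wSv; rewrite !inE => /andP[].
rewrite (tree_sum_rec vS wS wv).
rewrite (@set_cumulant_split _ _ _ Q0 (fun v B => q ^+ (\sum_(u in B) e v u)) _ _ v w) //.
- apply: eq_bigr => B /andP[wB BS].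
  have lt (C : {set V}) : C \proper S -> (#|C| < n)%N.
    by move=> CS; rewrite -ltnS; apply: leq_trans leSn; rewrite ltnS; apply: proper_card.
  have vB : v \notin B by apply/negP => /(subsetP BS); rewrite !inE eqxx.
  rewrite IHn; last 2 first.
  + apply: lt; rewrite properE subsetDl; apply/subsetPn; exists w => //.
    by rewrite inE wB.
  + by rewrite inE vB.
  congr (_ * _); rewrite -sum_expr_telescope big_distrr /=.
  apply: eq_bigr => i iB; rewrite IHn //; apply: lt; rewrite properE.
  rewrite (subset_trans BS (subsetDl _ _)); apply/subsetPn; by exists v.
- move=> u B D dBD; rewrite -exprD -bigU //; congr (_ ^+ _).
  by apply: eq_bigl => x; rewrite !inE.
- by move=> u B uB; rewrite inner_edgesU1 // exprD.
Qed.

End RootedTrees.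

(** * Spanning trees as edge sets *)

Section EdgeSets.
Variables (r : nat) (root : 'I_r).
Local Notation V := 'I_r.
Implicit Types (f : {ffun V -> V}) (i j x y : V) (c : seq V).

Definition parent_edges f : {set {set V}} := [set [set x; f x] | x : V & f x != x].

Lemma adj_parent_edges f x y :
  adj (parent_edges f) x y = (x != y) && ((f x == y) || (f y == x)).
Proof.
apply/imsetP/idP => [[z]|/andP[xy /orP[]/eqP fxy]].
- rewrite inE => fz /setP ez.
  have := ez x; have := ez y; have := ez z; have := ez (f z).
  rewrite !inE !eqxx ?orbT ?orTb.
  have [->|xz] := eqVneq x z => /=.
    rewrite (negbTE fz) /= => /eqP <- _ _ _.
    by rewrite eq_sym fz eqxx.
  by move=> _ /eqP <- _ /esym/eqP xf; rewrite xz -xf eqxx orbT.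
- by exists x; rewrite ?inE fxy // eq_sym.
- by exists y; rewrite ?inE fxy // setUC.
Qed.

Lemma adjC (T : {set {set V}}) x y : adj T x y = adj T y x.
Proof. by rewrite /adj setUC. Qed.

(** A simple path that does not start towards the parent never turns back: at each later vertex the
    only upward edge leads to its predecessor. *)
Lemma simple_path_descends f x c : f x \notin c -> uniq (x :: c) ->
  path (adj (parent_edges f)) x c -> path (fun a b => f b == a) x c.
Proof.
elim: c x => //= y c IH x; rewrite !inE !negb_or adj_parent_edges.
move=> /andP[fxy fxc] /andP[/andP[xy xc] /andP[yc uc]] /andP[/andP[_ a] pc].
rewrite (negbTE fxy) /= in a; rewrite a; apply: IH => //=; last by rewrite yc.
by rewrite (eqP a).
Qed.

Lemma descending_path_fconnect f x c i : path (fun a b => f b == a) x c ->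
  i \in x :: c -> fconnect f (last x c) i.
Proof.
elim: c x i => [|y c IH] x i /=; first by rewrite inE => _ /eqP->; apply: connect0.
move=> /andP[/eqP fy pc]; rewrite inE => /orP[/eqP->|]; last exact: IH.
have cy := IH y y pc (mem_head _ _).
by apply: connect_trans cy _; rewrite -fy; apply: fconnect1.
Qed.

Lemma fpath_closed f x c y : path (frel f) x c -> f (last x c) = last x c ->
  y \in x :: c -> f y \in x :: c.
Proof.
elim: c x => [|z c IH] x /=; first by move=> _ fx; rewrite !inE => /eqP->; apply/eqP.
move=> /andP[/eqP fx pc] fl; rewrite inE => /orP[/eqP->|/(IH _ pc fl) h].
  by rewrite fx !inE eqxx orbT.
by rewrite inE h orbT.
Qed.

Section Rooted.
Variable f : {ffun V -> V}.
Hypothesis fT : rooted_tree setT root f.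

Let froot : f root = root. Proof. by have [] := rooted_treeP _ _ _ fT. Qed.

Let con x : fconnect f x root.
Proof. by have [_ h _] := rooted_treeP _ _ _ fT; apply: h; rewrite inE. Qed.

Lemma rooted_fixedE x : (f x == x) = (x == root).
Proof.
apply/eqP/eqP => [fx|->//]; by rewrite (fconnect_fixed fx (con x)).
Qed.

(** Mutual reachability makes the orbit of [x] periodic, but every orbit ends at the fixed root; so
    either the period is 0 or [x] is the root. *)
Lemma rooted_fconnect_antisym x y : fconnect f x y -> fconnect f y x -> x = y.
Proof.
move=> /fconnect_iterP[a ea] /fconnect_iterP[b eb].
have /fconnect_iterP[n en] := con x.
have xper k : iter (k * (b + a)) f x = x.
  by elim: k => //= k IH; rewrite mulSn iterD IH iterD ea.
have [] := posnP (b + a) => [/eqP|ab].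
  by rewrite addn_eq0 => /andP[_ /eqP a0]; rewrite -ea a0.
have itr k : iter k f root = root by elim: k => //= k ->.
have xroot : x = root.
  have le : (n <= n * (b + a))%N by rewrite leq_pmulr.
  by rewrite -(xper n) -(subnK le) iterD en itr.
by rewrite -ea xroot itr.
Qed.

Lemma ancestor_parent_edges i j : ancestor (parent_edges f) root i j = fconnect f j i.
Proof.
apply/ancestorP/idP => [[c [pc uc <- ic]]|ji].
  apply: (descending_path_fconnect _ ic); apply: simple_path_descends => //.
  by rewrite froot; case/andP: uc.
have /connectP[p pp] := con j.
case/shortenP: pp => c pc uc _ lc.
(* The orbit from [j] to the root, made simple and read backwards; [belast] drops the root, which
   heads the path. It contains [i] because [j :: c], ending in a fixed point, is closed under
   [f]. *)
exists (rev (belast j c)).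
have ec : root :: rev (belast j c) = rev (j :: c) by rewrite [j :: c]lastI -lc rev_rcons.
rewrite ec rev_uniq; split=> //.
- rewrite lc rev_path.
  elim: c (j) pc uc {lc ec} => //= y c IH x /andP[/eqP fx pc] /andP[xyc uc].
  rewrite IH // andbT adj_parent_edges fx eqxx orbT andbT.
  by move: xyc; rewrite inE negb_or eq_sym => /andP[].
- case: (c) lc => [->//|y s _]; by rewrite /= rev_cons last_rcons.
- rewrite mem_rev; apply: (fconnect_closed (D := mem (j :: c))) ji => /=.
    by move=> z; apply: fpath_closed; rewrite // -lc.
  exact: mem_head.
Qed.

Lemma parent_parent_edges i : parent (parent_edges f) root i = f i.
Proof.
rewrite /parent; case: pickP => [p /and3P[pi]|none] /=.
  rewrite adj_parent_edges pi ancestor_parent_edges => /orP[/eqP fp ip|/eqP//].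
  have := rooted_fconnect_antisym ip; rewrite -fp => /(_ (fconnect1 _ _)) fpp.
  by rewrite -fp fpp eqxx in pi.
have [fi|fi] := eqVneq (f i) i; first by rewrite fi.
have := none (f i); rewrite fi adj_parent_edges fi eqxx orbT ancestor_parent_edges.
by rewrite fconnect1.
Qed.

Lemma connected_parent_edges : connected (parent_edges f).
Proof.
have toroot x : connect (adj (parent_edges f)) x root.
  have /fconnect_iterP[n] := con x; elim: n x => [|n IH] x.
    by move=> /= ->; apply: connect0.
  rewrite iterSr => /IH; apply: connect_trans.
  have [->|fx] := eqVneq (f x) x; first exact: connect0.
  by apply: connect1; rewrite adj_parent_edges eqxx eq_sym fx.
apply/'forall_forallP => x y; apply: connect_trans (toroot x) _.
by rewrite (sym_connect_sym (@adjC _)).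
Qed.

(** [#|fconnect f x|] counts the ancestors of [x], itself included, and serves as its depth. *)
Lemma card_fconnect_parent x : f x != x -> (#|fconnect f (f x)| < #|fconnect f x|)%N.
Proof.
move=> fx; apply: proper_card; apply/properP; split.
  by apply/subsetP => y; apply: connect_trans (fconnect1 _ _).
exists x; first exact: connect0.
apply/negP => fxx; move/eqP: fx; apply.
exact: (rooted_fconnect_antisym fxx (fconnect1 _ _)).
Qed.

(* Both neighbours on a cycle of a vertex of maximal depth are its parent. *)
Lemma acyclic_parent_edges : acyclic (parent_edges f).
Proof.
apply/acyclicP => c /andP[cc uc]; rewrite leqNgt; apply/negP => sc.
have [x0 x0c] : exists x0, x0 \in c by case: (c) sc => // a; exists a; rewrite mem_head.
pose x := [arg max_(x > x0 in c) #|fconnect f x|].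
have [xc maxx] : x \in c /\ forall y, y \in c -> (#|fconnect f y| <= #|fconnect f x|)%N.
  by rewrite /x; case: arg_maxnP.
have nb y : y \in c -> adj (parent_edges f) x y -> y = f x.
  move=> yc; rewrite adj_parent_edges => /andP[xy /orP[/eqP->//|/eqP fy]].
  have := maxx y yc; rewrite leqNgt -fy card_fconnect_parent //.
  by rewrite fy.
have [k c' ec] := rot_to xc.
have mc : c =i x :: c' by move=> y; rewrite -ec mem_rot.
move: cc uc sc; rewrite -(rot_cycle k) -(rot_uniq k) -(size_rot k) ec.
case: c' ec mc => [//|y c'] _ mc; case/lastP: c' mc => [//|c' z] mc.
rewrite /= rcons_path last_rcons => /and3P[axy _ azx] /and3P[_ + _] _.
have -> : y = f x by apply: nb axy; rewrite mc !inE eqxx orbT.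
have <- : z = f x by apply: nb; rewrite ?mc ?inE ?mem_rcons ?mem_head ?orbT // adjC.
by rewrite mem_rcons mem_head.
Qed.

End Rooted.

(** A breadth-first tree: [d x] is the length of a shortest path from the root to [x], and [f x] is
    a neighbour of [x] nearer to the root. *)
Lemma connected_rooted_subtree (T : {set {set V}}) : connected T ->
  exists2 f, rooted_tree setT root f & forall x, f x != x -> adj T (f x) x.
Proof.
move=> /'forall_forallP conT.
pose P x n := [exists c : n.-tuple V, path (adj T) root c && (last root c == x)].
have exP x : exists n, P x n.
  have /connectP[c pc lc] := conT root x.
  by exists (size c); apply/existsP; exists (in_tuple c); rewrite pc lc eqxx.
pose d x := ex_minn (exP x).
have dP x : x != root -> exists y, adj T y x && (d y < d x)%N.
  move=> xr; rewrite {2}/d; case: ex_minnP => n /existsP[c /andP[pc /eqP lc]] _.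
  case: c pc lc => c /= /eqP <-; case/lastP: c => [|c z].
    by move=> _ /= rx; rewrite rx eqxx in xr.
  rewrite rcons_path last_rcons size_rcons => /andP[pc az] <-.
  exists (last root c); rewrite az /d ltnS; case: ex_minnP => m _; apply.
  by apply/existsP; exists (in_tuple c); rewrite pc eqxx.
pose f := [ffun x => if x == root then x else
             odflt x [pick y | adj T y x && (d y < d x)%N]].
have fP x : x != root -> adj T (f x) x && (d (f x) < d x)%N.
  move=> xr; rewrite ffunE (negbTE xr); case: pickP => //= none.
  by have [y] := dP x xr; rewrite none.
have fr : f root = root by rewrite ffunE eqxx.
exists f => [|x]; last by have [->|/fP/andP[]] := eqVneq x root; rewrite ?fr ?eqxx.
apply/rooted_treeP; split=> // [x _|x]; last by rewrite inE.
have [n] := ubnP (d x); elim: n x => // n IHn x ltx.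
have [->|xr] := eqVneq x root; first exact: connect0.
apply: connect_trans (fconnect1 _ _) (IHn _ _).
by have /andP[_ h] := fP x xr; apply: leq_trans h ltx.
Qed.

Lemma spanning_treeP e (T : {set {set V}}) :
  reflect (exists f, [/\ rooted_tree setT root f, parent_edges f = T &
                         T \subset simple_edges e]) (spanning_tree e T).
Proof.
apply: (iffP and3P) => [[sT cT aT]|[f [fT <- sT]]]; last first.
  by split; rewrite ?connected_parent_edges ?acyclic_parent_edges.
have [f fT fadj] := connected_rooted_subtree cT; exists f; split=> //.
have sub x y : adj (parent_edges f) x y -> adj T x y.
  rewrite adj_parent_edges => /andP[xy /orP[]/eqP fxy].
    by rewrite -fxy adjC fadj // fxy eq_sym.
  by rewrite -fxy fadj // fxy.
apply/eqP; rewrite eqEsubset; apply/andP; split; apply/subsetP => A AT.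
  by case/imsetP: (AT) => x _ eA; move: AT; rewrite eA; apply: sub.
have /imsetP[[a b]] := subsetP sT A AT; rewrite inE /= => /andP[ab _] eA.
rewrite {}eA in AT *; rewrite -/(adj T a b) in AT; rewrite -/(adj _ a b).
(* An edge of [T] between [a] and [b] closes a simple path of the breadth-first tree into a cycle.
   Since [T] is acyclic the cycle has at most two vertices, so the path is that edge itself. *)
have /'forall_forallP/(_ a b)/connectP[p pp] := connected_parent_edges fT.
case/shortenP: pp => c pc uc _ lc.
have : ucycle (adj T) (a :: c).
  rewrite /ucycle uc andbT /= rcons_path -lc adjC AT andbT.
  exact: sub_path pc.
move=> /(acyclicP _ aT); case: c pc uc lc => [|y [|//]] /=.
  by move=> _ _ ba; rewrite ba eqxx in ab.
by rewrite andbT => h _ -> _.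
Qed.

(** * Comparison with the inversion polynomial *)

Section TreeSum.
Variables (R : comNzRingType) (q : R) (e : multigraph r).
Hypothesis e_sym : forall i j, e i j = e j i.

Lemma subr1_qint n : (q - 1) * qint q n = q ^+ n - 1.
Proof. by rewrite subrX1. Qed.

(** Each edge is named by its child. The inverse map would pick the wrong end only if [f (f x) = x],
    which antisymmetry of reachability excludes for [x] other than the root. *)
Lemma prod_tree_edges (F : V -> V -> R) f : rooted_tree setT root f ->
  (forall i j, F i j = F j i) ->
  \prod_(ij : V * V | (ij.1 < ij.2)%N && ([set ij.1; ij.2] \in parent_edges f))
     F ij.1 ij.2 = \prod_(x | x != root) F (f x) x.
Proof.
move=> fT F_sym.
rewrite (reindex_onto (fun x => if (x < f x)%N then (x, f x) else (f x, x))
                      (fun ij => if f ij.1 == ij.2 then ij.1 else ij.2)) /=; last first.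
  move=> [i j] /= /andP[ij]; rewrite -/(adj _ i j) adj_parent_edges.
  case: eqVneq => //= _; case: eqVneq => [fi _|_ /eqP fj]; first by rewrite fi ij.
  by rewrite fj ltnNge ltnW.
apply: eq_big => [x|x _]; last by case: ifP => //= _; rewrite F_sym.
rewrite -(rooted_fixedE fT); case: (ltngtP x (f x)) => /= [ltx|ltx|/ord_inj fx].
- rewrite ltx /= eqxx -/(adj _ _ _) adj_parent_edges eqxx andbT eqxx andbT.
  by rewrite eq_sym.
- rewrite ltx -/(adj _ _ _) adj_parent_edges eqxx orbT andbT.
  have [//|fx] /= := eqVneq (f x) x; have [ffx|_] := eqVneq (f (f x)) x; last by rewrite eqxx.
  have ffx' : fconnect f (f x) x by rewrite -{2}ffx fconnect1.
  by case/eqP: fx; apply: (rooted_fconnect_antisym fT ffx' (fconnect1 _ _)).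
- by rewrite -fx ltnn eqxx.
Qed.

(** The right-hand sum admits more pairs, but those with [e (f i) j = 0] add nothing, and the root
    is no descendant of another vertex. *)
Lemma kappa_stat_parent_edges f : rooted_tree setT root f ->
  kappa_stat e (parent_edges f) root =
  (\sum_(i | i != root) \sum_(j : V | (j < i)%N && fconnect f j i) e (f i) j)%N.
Proof.
move=> fT; rewrite pair_big_dep /kappa_stat /= big_mkcond [RHS]big_mkcond /=.
apply: eq_bigr => [[i j]] _ /=.
rewrite /kappa_inversion (ancestor_parent_edges fT) (parent_parent_edges fT).
case: eqVneq => //= ir; have [->|jr] /= := eqVneq j root.
  case: ifP => // /andP[_ rooti]; case/eqP: ir; apply: fconnect_fixed rooti.
  by have [] := rooted_treeP _ _ _ fT.
case: (fconnect f j i); case: (j < i)%N => //=.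
by case: (posnP (e (f i) j)) => [->|].
Qed.

Lemma tree_weight_rooted f : rooted_tree setT root f ->
  tree_weight q e f = (q - 1) ^+ r.-1 * (q ^+ kappa_stat e (parent_edges f) root *
    \prod_(ij : V * V | (ij.1 < ij.2)%N && ([set ij.1; ij.2] \in parent_edges f))
       qint q (e ij.1 ij.2)).
Proof.
move=> fT; rewrite (prod_tree_edges (F := fun i j => qint q (e i j)) fT); last first.
  by move=> i j; rewrite e_sym.
rewrite kappa_stat_parent_edges // expr_sum.
have -> : (q - 1) ^+ r.-1 = \prod_(i : V | i != root) (q - 1).
  by rewrite prodr_const cardC1 card_ord.
rewrite -!big_split /tree_weight (bigD1 root) //= /vertex_weight.
rewrite (rooted_fixedE fT) eqxx mul1r; apply: eq_bigr => i ir.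
by rewrite (rooted_fixedE fT) (negbTE ir) mulrCA subr1_qint.
Qed.

Theorem Ginv_poly_tree_sum :
  (q - 1) ^+ r.-1 * Ginv_poly q root e = q ^+ loops e * tree_sum q e setT root.
Proof.
rewrite /Ginv_poly mulrCA; congr (_ * _).
rewrite (reindex_onto parent_edges (fun T => [ffun x => parent T root x])) /=; last first.
  move=> T /spanning_treeP[f [fT <- _]]; congr parent_edges.
  by apply/ffunP => x; rewrite ffunE (parent_parent_edges fT).
rewrite big_distrr /= /tree_sum [RHS](bigID (fun f => parent_edges f \subset simple_edges e)) /=.
(* A parent function with an edge outside the graph has a vertex of weight 0. *)
rewrite [X in _ = _ + X]big1 ?addr0.
  apply: eq_big => [f|f /andP[/spanning_treeP[g [gT eg _]] /eqP ef]].
    (* [spanning_treeP] only yields some [g] with the same edges; parents read off the edges give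
       [f = g]. *)
    apply/andP/andP => [[/spanning_treeP[g [gT eg sg]] /eqP ef]|[fT sf]].
      suff -> : f = g by rewrite gT eg.
      by rewrite -ef; apply/ffunP => x; rewrite ffunE -eg (parent_parent_edges gT).
    split; first by apply/spanning_treeP; exists f.
    by apply/eqP/ffunP => x; rewrite ffunE (parent_parent_edges fT).
  suff -> : f = g by rewrite tree_weight_rooted.
  by rewrite -ef; apply/ffunP => x; rewrite ffunE -eg (parent_parent_edges gT).
move=> f /andP[fT /subsetPn[A /imsetP[x]]]; rewrite inE => fx eA nA.
have e0 : e (f x) x = 0%N.
  apply/eqP; rewrite -leqn0 leqNgt; apply: contra nA => ex; rewrite eA.
  by apply/imsetP; exists (f x, x); rewrite ?inE ?fx //= setUC.
rewrite /tree_weight (bigD1 x) //= /vertex_weight (negbTE fx) e0 expr0 subrr.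
by rewrite mulr0 mul0r.
Qed.

End TreeSum.
End EdgeSets.

(** * Products of sums over fillings *)

Lemma big_seq_bij (R : Type) (idx : R) (op : Monoid.com_law idx) (I J : eqType)
  (s : seq I) (t : seq J) (h : I -> J) (h' : J -> I) (F : I -> R) (G : J -> R) :
  uniq s -> uniq t ->
  {in s, forall x, [/\ h x \in t, h' (h x) = x & F x = G (h x)]} ->
  {in t, forall y, h' y \in s /\ h (h' y) = y} ->
  \big[op/idx]_(x <- s) F x = \big[op/idx]_(y <- t) G y.
Proof.
move=> us ut hs ht.
rewrite (eq_big_seq (G \o h)) => [|x /hs[]//].
rewrite -(big_map h xpredT G); apply: perm_big; apply: uniq_perm => //.
  by rewrite map_inj_in_uniq // => x y /hs[_ kx _] /hs[_ ky _] e; rewrite -kx e ky.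
move=> y; apply/mapP/idP => [[x /hs[+ _ _] ->]//|/ht[y's e]].
by exists (h' y).
Qed.

Section SupportedFillings.
Local Open Scope mset_scope.
Variable Z : finType.
Implicit Types (f : {ffun Z -> nat}) (A B : {set Z}) (m : monomial).

Definition positive_values f : monomial :=
  seq_mset (pmap insub [seq f z | z <- enum Z]).

Lemma positive_valuesE f (k : posint) :
  positive_values f k = (\sum_z (f z == val k))%N.
Proof.
rewrite /positive_values mset_seqE -big_enum /=.
elim: (enum Z) => [|z s IH] /=; first by rewrite big_nil.
rewrite big_cons -IH; case: insubP => [u _ eu|] /=; first by rewrite -eu val_eqE.
rewrite -eqn0Ngt => /eqP ->; case: eqP => // k0.
by have /= := valP k; rewrite -k0.
Qed.

(* A filling of [A] is extended by [0] to all of [Z]. *)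
Definition supported_fillings A m : {fset {ffun Z -> nat}} :=
  [fset f in [seq [ffun z => oapp (fun k : finsupp m => val (val k)) 0%N (u z)] |
      u : {ffun Z -> option (finsupp m)} <- enum {: {ffun Z -> option (finsupp m)}}] |
    [forall z, (0 < f z)%N == (z \in A)] && (positive_values f == m)]%fset.

(** The finite list of candidates loses nothing: each positive value of [f] occurs in the support of
    its monomial. *)
Lemma supported_fillingsP A m f :
  reflect ((forall z, (0 < f z)%N = (z \in A)) /\ positive_values f = m)
          (f \in supported_fillings A m).
Proof.
rewrite !inE /=; apply: (iffP andP) => [[_ /andP[/forallP h /eqP->]]|[h em]].
  by split=> // z; rewrite (eqP (h z)).
split; last by rewrite em eqxx andbT; apply/forallP => z; rewrite h.
have fm z (fz : (0 < f z)%N) : Sub (f z) fz \in finsupp m.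
  rewrite -em multiset.msuppE (perm_mem (perm_eq_seq_mset _)) mem_pmap.
  by apply/mapP; exists (f z); rewrite ?insubT //; apply: map_f; rewrite mem_enum.
pose u z : option (finsupp m) := obind insub (insub (f z) : option posint).
apply/mapP; exists (finfun u); first by rewrite mem_enum.
apply/ffunP => z; rewrite !ffunE /u; case: insubP => [x fz ex|] /=.
  have xm : x \in finsupp m.
    by rewrite (_ : x = Sub (f z) fz) //; apply: val_inj.
  by rewrite insubT /= ex.
by rewrite -eqn0Ngt => /eqP.
Qed.

Definition restrict A f : {ffun Z -> nat} := [ffun z => if z \in A then f z else 0%N].

Lemma positive_values_split A B f : [disjoint A & B] ->
  (forall z, (0 < f z)%N = (z \in A :|: B)) ->
  positive_values f = positive_values (restrict A f) `+` positive_values (restrict B f).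
Proof.
move=> dAB sf; apply/msetP => k; rewrite msetE2 !positive_valuesE -big_split /=.
apply: eq_bigr => z _; rewrite !ffunE.
have k0 : (0%N == val k) = false by rewrite eq_sym; case: (val k) (valP k).
have := sf z; rewrite inE; have [zA|zA] /= := boolP (z \in A).
  by rewrite (disjointFr dAB zA) k0 addn0.
by case: ifP => // _; rewrite k0; case: (f z) => // _; rewrite k0.
Qed.

Section Sums.
Variable K : comNzRingType.
Implicit Types c : {ffun Z -> nat} -> K.

Definition supported_sum A c : series K :=
  fun m => \sum_(f <- supported_fillings A m) c f.

(** A function supported on [A :|: B] is the same as its pair of restrictions, recovered by
    addition; the monomial of the restriction to [A] selects the term of the convolution. *)
Lemma smul_supported_sum A B c1 c2 : [disjoint A & B] ->
  smul (supported_sum A c1) (supported_sum B c2) =1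
  supported_sum (A :|: B) (fun f => c1 (restrict A f) * c2 (restrict B f)).
Proof.
move=> dAB m; rewrite /smul /supported_sum.
set S := supported_fillings (A :|: B) m.
have subm f : f \in S -> positive_values (restrict A f) \in submonomials m.
  case/supported_fillingsP => sf <-; rewrite mem_submonomials.
  rewrite (positive_values_split dAB sf); apply/msubsetP => k.
  by rewrite msetE2 leq_addr.
transitivity (\sum_(m' <- submonomials m)
   \sum_(f <- [seq f <- S | positive_values (restrict A f) == m'])
     c1 (restrict A f) * c2 (restrict B f)); last first.
  under eq_bigr => m' _ do rewrite big_filter.
  rewrite (exchange_big_dep xpredT) //= big_seq [RHS]big_seq; apply: eq_bigr => f fS.
  rewrite (eq_bigl (pred1 (positive_values (restrict A f)))) => [|m']; last exact: eq_sym.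
  by rewrite -big_filter filter_pred1_uniq ?fset_uniq ?subm ?big_seq1.
rewrite big_seq [RHS]big_seq; apply: eq_bigr => m'; rewrite mem_submonomials => m'm.
rewrite big_distrlr /= -(big_allpairs (F := fun x => c1 x.1 * c2 x.2)) /=.
pose h (x : {ffun Z -> nat} * {ffun Z -> nat}) := [ffun z => (x.1 z + x.2 z)%N].
pose h' (f : {ffun Z -> nat}) := (restrict A f, restrict B f).
apply: (big_seq_bij _ (h := h) (h' := h')).
- by apply: allpairs_uniq; rewrite ?fset_uniq // => -[x1 x2] [y1 y2].
- by rewrite filter_uniq ?fset_uniq.
- move=> _ /allpairsP[[f1 f2] /= [/supported_fillingsP[s1 p1] /supported_fillingsP[s2 p2] ->]] /=.
  set f := h _.
  have fA : restrict A f = f1.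
    apply/ffunP => z; rewrite !ffunE; have := s2 z; have := s1 z.
    have [zA|_] := boolP (z \in A); last by case: (f1 z).
    by rewrite (disjointFr dAB zA); case: (f2 z) => // _ _; rewrite addn0.
  have fB : restrict B f = f2.
    apply/ffunP => z; rewrite !ffunE; have := s1 z; have := s2 z.
    have [zB|_] := boolP (z \in B); last by case: (f2 z).
    by rewrite (disjointFl dAB zB); case: (f1 z).
  rewrite /h' fA fB; split=> //.
  have sf z : (0 < f z)%N = (z \in A :|: B) by rewrite ffunE addn_gt0 s1 s2 inE.
  rewrite mem_filter fA p1 eqxx; apply/supported_fillingsP; split=> //.
  by rewrite (positive_values_split dAB sf) fA fB p1 p2 msetBDKC.
- move=> f; rewrite mem_filter => /andP[/eqP em' /supported_fillingsP[sf ef]].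
  split; last first.
    apply/ffunP => z; rewrite !ffunE; have := sf z; rewrite inE.
    have [zA|zA] /= := boolP (z \in A); first by rewrite (disjointFr dAB zA) addn0.
    by case: ifP => //= _; case: (f z).
  have sA z : (0 < restrict A f z)%N = (z \in A).
    by rewrite ffunE; case: ifP => // zA; rewrite sf inE zA.
  have sB z : (0 < restrict B f z)%N = (z \in B).
    by rewrite ffunE; case: ifP => // zB; rewrite sf inE zB orbT.
  apply/allpairsP; exists (restrict A f, restrict B f); split=> //=.
    by apply/supported_fillingsP.
  apply/supported_fillingsP; split=> //.
  by rewrite -ef (positive_values_split dAB sf) em' msetDKB.
Qed.

Lemma supported_sum0 m : supported_sum set0 (fun=> 1) m = sone K m.
Proof.
rewrite /supported_sum /sone.
have [->|m0] := eqVneq m mset0.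
  rewrite (_ : supported_fillings _ _ = [fset [ffun=> 0%N]]%fset) ?big_seq_fset1 //.
  apply/fsetP => f; rewrite inE; apply/supported_fillingsP/eqP => [[sf _]|->].
    by apply/ffunP => z; rewrite ffunE; have := sf z; rewrite inE; case: (f z).
  split=> [z|]; first by rewrite ffunE inE.
  apply/msetP => k; rewrite positive_valuesE mset0E big1 // => z _.
  by rewrite ffunE; case: (val k) (valP k).
rewrite big_seq big1 // => f /supported_fillingsP[sf ef]; case/eqP: m0.
rewrite -ef; apply/msetP => k; rewrite positive_valuesE mset0E big1 // => z _.
by have := sf z; rewrite inE; case: (f z) => // _; case: (val k) (valP k).
Qed.

Lemma big_smul_supported_sum (I : finType) (L : seq I) (D : I -> {set Z})
    (F : I -> series K) (c : I -> {ffun Z -> nat} -> K) :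
  uniq L -> {in L &, forall x y, x != y -> [disjoint D x & D y]} ->
  (forall x, F x =1 supported_sum (D x) (c x)) ->
  \big[@smul K/@sone K]_(x <- L) F x =1
  supported_sum (\bigcup_(x <- L) D x) (fun f => \prod_(x <- L) c x (restrict (D x) f)).
Proof.
move=> uL dL eF; elim: L uL dL => [|x L IH] /= => [_ _ m|/andP[xL uL] dL m].
  rewrite !big_nil -supported_sum0; apply: eq_bigr => f _; by rewrite big_nil.
have dxL : [disjoint D x & \bigcup_(y <- L) D y].
  rewrite disjoint_sym bigcup_seq disjoints_subset; apply/bigcupsP => y yL.
  rewrite -disjoints_subset dL ?mem_head ?inE ?yL ?orbT //.
  by apply: contraNneq xL => <-.
rewrite !big_cons.
transitivity (smul (supported_sum (D x) (c x))
  (supported_sum (\bigcup_(y <- L) D y) (fun f => \prod_(y <- L) c y (restrict (D y) f))) m).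
  apply: eq_bigr => m' _; rewrite eF IH // => y z yL zL.
  by apply: dL; rewrite inE ?yL ?zL orbT.
rewrite smul_supported_sum //; apply: eq_bigr => f _; rewrite big_cons; congr (_ * _).
apply: eq_big_seq => y yL; congr (c y _); apply/ffunP => z; rewrite !ffunE.
case: ifP => // zy; rewrite ifT // bigcup_seq; by apply/bigcupP; exists y.
Qed.

End Sums.
End SupportedFillings.

(** * Columns of the diagrams *)

Section SeqFacts.
Local Open Scope nat_scope.

(** [count P (take i s)] is the position in [filter P s] of the entry of [s] at [i]. *)
Lemma nth_filter_count (T : Type) (P : pred T) x0 s i :
  i < size s -> P (nth x0 s i) ->
  nth x0 (filter P s) (count P (take i s)) = nth x0 s i.
Proof.
elim: s i => [|x s IH] [|i] //= lti Pi; first by rewrite Pi.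
by case: (P x) => /=; apply: IH.
Qed.

Lemma filter_position (T : Type) (P : pred T) x0 s k : k < count P s ->
  exists i, [/\ i < size s, P (nth x0 s i) & count P (take i s) = k].
Proof.
elim: s k => [|x s IH] //= k; case Px: (P x).
  case: k => [_|k]; first by exists 0.
  by rewrite add1n ltnS => /IH[i [lti Pi ci]]; exists i.+1; rewrite /= Px ci.
by rewrite add0n => /IH[i [lti Pi ci]]; exists i.+1; rewrite /= Px.
Qed.

Lemma onth_some (T : Type) x0 (s : seq T) i : i < size s -> onth s i = Some (nth x0 s i).
Proof. by move=> lti; rewrite onthE (nth_map x0). Qed.

Lemma ltn_count_take (T : Type) (P : pred T) x0 s i j :
  i <= j -> j < size s -> P (nth x0 s j) ->
  count P (take i s) < count P (take j.+1 s).
Proof.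
move=> ij js Pj; rewrite (take_nth x0 js) -cats1 count_cat /= Pj addn1 ltnS.
by rewrite -(subnKC ij) takeD count_cat leq_addr.
Qed.

(** In a weakly decreasing sequence the entries at least [j] form an initial segment. *)
Lemma ltn_count_geq (s : seq nat) j i : sorted geq s ->
  (i < count (leq j) s) = (i < size s) && (j <= nth 0 s i).
Proof.
elim: s i => [|h s IH] i //= hs; have IHs := IH _ (path_sorted hs).
have /allP minh : all (geq h) s by apply: order_path_min hs => x y z /= yx zy; exact: leq_trans zy yx.
have [jh|hj] := leqP j h; first by case: i => [|i] //=; rewrite add1n !ltnS IHs.
rewrite add0n (_ : count _ _ = 0); last first.
  apply/eqP; rewrite -leqn0 leqNgt -has_count; apply/hasPn => x /minh xh.
  by rewrite -ltnNge (leq_ltn_trans xh hj).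
apply/esym; case: i => [|i] /=; first by rewrite leqNgt hj.
rewrite ltnS; apply/negP => /andP[lti ji].
have /= xh := minh _ (mem_nth 0 lti).
by move: (leq_ltn_trans (leq_trans ji xh) hj); rewrite ltnn.
Qed.

Lemma sorted_geq_nth (s : seq nat) i : sorted geq s -> nth 0 s i.+1 <= nth 0 s i.
Proof.
move=> /(sortedP 0) hs; have [lti|gei] := ltnP i.+1 (size s); first exact: hs.
by rewrite nth_default.
Qed.

Lemma count_ltn_iota n h : n <= h -> count (fun i => i < n) (iota 0 h) = n.
Proof.
move=> nh; rewrite -(subnKC nh) iotaD count_cat add0n.
rewrite (eq_in_count (a2 := predT)) => [|i]; last by rewrite mem_iota => /= ->.
rewrite count_predT size_iota (eq_in_count (a2 := pred0)) ?count_pred0 ?addn0 // => i.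
by rewrite mem_iota => /andP[ni _]; rewrite ltnNge ni.
Qed.

Lemma count_conj_part (la : seq nat) j : is_partition la ->
  count (leq j.+1) (conj_part la) = nth 0 la j.
Proof.
move=> /andP[sla _]; rewrite /conj_part /mkseq count_map.
rewrite (eq_count (a2 := fun i => i < nth 0 la j)) => [|i /=]; last first.
  rewrite ltn_count_geq //; have [//|gej] := ltnP j (size la).
  by rewrite nth_default.
apply: count_ltn_iota; rewrite -nth0.
by elim: j => // j IH; apply: leq_trans (sorted_geq_nth _ sla) IH.
Qed.

End SeqFacts.

Section Columns.
Local Open Scope nat_scope.
Variables (r : nat) (la : 'I_r -> seq nat).
Hypothesis hla : forall b, is_partition (la b).
Implicit Types (B : {set 'I_r}) (p : nat * nat).

Lemma nth_opluspart B j : nth 0 (opluspart la B) j = \sum_(b in B) nth 0 (la b) j.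
Proof.
rewrite /opluspart; have [ltj|gej] := ltnP j (\max_(b in B) size (la b)).
  by rewrite nth_mkseq.
rewrite nth_default ?size_mkseq // big1 // => b bB; rewrite nth_default //.
by apply: leq_trans gej; apply: (leq_bigmax_cond b).
Qed.

Lemma sorted_opluspart B : sorted geq (opluspart la B).
Proof.
apply/(sortedP 0) => i _; rewrite !nth_opluspart /=; apply: leq_sum => b _.
by apply: sorted_geq_nth; case/andP: (hla b).
Qed.

Definition columns_in B := [seq c <- columns la | c.2 \in B].
Definition heights_in B := [seq c.1 | c <- columns_in B].

Lemma sorted_heights B : sorted geq (heights_in B).
Proof.
rewrite /heights_in sorted_map; apply: sorted_filter.
  by move=> x y z /= yx zy; exact: leq_trans zy yx.
apply: (sub_sorted (e := @column_le r)) => [c d|]; last apply: sort_sorted.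
  by case/orP => [/ltnW//|/andP[/eqP /= -> _]]; apply: leqnn.
move=> c d; rewrite /column_le; case: ltngtP => //= _.
exact: leq_total.
Qed.

(** Each part contributes to row [j] its number of columns of height above [j]. With
    [sorted_heights] this makes [heights_in B] the conjugate of lambda^B, so the columns of lambda^B
    are those of lambda^[r] with a color in [B], in the same order. *)
Lemma count_heights B j : count (leq j.+1) (heights_in B) = nth 0 (opluspart la B) j.
Proof.
rewrite nth_opluspart count_map count_filter /columns.
rewrite (seq.permP (permEl (perm_sort _ _))) -sum1_count big_mkcond big_allpairs_dep /=.
rewrite big_enum /= [RHS]big_mkcond /=; apply: eq_bigr => b _.
rewrite -big_mkcond sum1_count -(count_conj_part _ (hla b)); case: ifP => bB.
  by apply: eq_count => h; rewrite /= andbT.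
by rewrite (eq_count (a2 := pred0)) ?count_pred0 // => h; rewrite /= andbF.
Qed.

Lemma in_diagram_heights B p : (p \in diagram (opluspart la B)) =
  [&& 0 < p.1, 0 < p.2 & p.2 <= nth 0 (heights_in B) p.1.-1].
Proof.
case: p => [i j]; rewrite in_diagram /=.
case: i => [|i]; first by rewrite /= !andbF.
case: j => [|j] //=; rewrite -count_heights ltn_count_geq ?sorted_heights //.
have [lti|gei] := ltnP i (size (heights_in B)); last first.
  by rewrite andbF nth_default.
have [hj|] := ltnP j (nth 0 (heights_in B) i); last by rewrite /= andbF.
rewrite /= andbT ltnNge; apply/negP => gej.
suff : i < nth 0 (opluspart la B) j by rewrite nth_default.
by rewrite -count_heights ltn_count_geq ?sorted_heights // lti hj.
Qed.

Lemma leg_heights B p : p \in diagram (opluspart la B) ->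
  leg (opluspart la B) p = nth 0 (heights_in B) p.1.-1 - p.2.
Proof.
rewrite in_diagram_heights => /and3P[p1 p2 hp]; rewrite /leg; congr subn.
move: p1 hp; case: p.1 => // i _ /=; set n := nth 0 (heights_in B) i => hp.
have ln : i < size (heights_in B).
  by rewrite ltnNge; apply: contraTN p2 => ?; rewrite -leqNgt (leq_trans hp) // /n nth_default.
(* Counting from 0, row [j] reaches column [i] exactly when column [i] is higher than [j]. Two
   naturals with the same smaller numbers are equal. *)
have key j : (j < count (leq i.+1) (opluspart la B)) = (j < n).
  rewrite ltn_count_geq ?sorted_opluspart // -count_heights ltn_count_geq ?sorted_heights //.
  rewrite ln -/n /=; case: ltnP => //= gej; apply/esym/negP => jn.
  suff : i < nth 0 (opluspart la B) j by rewrite nth_default.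
  by rewrite -count_heights ltn_count_geq ?sorted_heights // ln.
have -> : nth 0 (conj_part (opluspart la B)) i = count (leq i.+1) (opluspart la B).
  rewrite /conj_part nth_mkseq // -nth0 -count_heights ltn_count_geq ?sorted_heights //.
  by rewrite ln (leq_trans p2 hp).
by apply/eqP; rewrite eqn_leq leqNgt key ltnn /= leqNgt -key ltnn.
Qed.

Definition colored B p := oapp (fun b => b \in B) false (color la p).

(* The box of [lambda^B] corresponding to the box [p] of [lambda^[r]]; boxes
   with a color outside [B] are sent to the nonexistent column [0]. *)
Definition squeeze B p : nat * nat :=
  (if colored B p then count (fun c => c.2 \in B) (take p.1 (columns la)) else 0, p.2).

Lemma colored_nth B p : colored B p ->
  p.1.-1 < size (columns la) /\
  forall x0, (nth x0 (columns la) p.1.-1).2 \in B.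
Proof.
rewrite /colored /color; have [lti|gei] := ltnP p.1.-1 (size (columns la)); last first.
  by rewrite onth_default.
by move=> cB; split=> // x0; move: cB; rewrite (onth_some x0 lti).
Qed.

Lemma heights_squeeze B p : colored B p -> 0 < p.1 ->
  0 < (squeeze B p).1 /\
  nth 0 (heights_in B) (squeeze B p).1.-1 = nth 0 (heights_in setT) p.1.-1.
Proof.
move=> cB; have [lti cn] := colored_nth cB; rewrite /squeeze cB /=.
case: p {cB} lti cn => [[|i] j] //= lti cn _.
have x0 : nat * 'I_r by case: (columns la) lti => // x.
have cnx := cn x0.
rewrite (take_nth x0 lti) -cats1 count_cat /= cnx addn1; split=> //=.
rewrite /heights_in (nth_map x0); last first.
  rewrite size_filter -[X in _ < count _ X](cat_take_drop i.+1) count_cat.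
  by apply: leq_trans (leq_addr _ _); apply: ltn_count_take cnx.
rewrite (nth_filter_count (P := fun c => c.2 \in B)) //.
rewrite /columns_in (eq_filter (a2 := predT)) ?filter_predT ?(nth_map x0) // => c.
by rewrite inE.
Qed.

Lemma squeeze_in_diagram B p : (squeeze B p \in diagram (opluspart la B)) =
  (p \in diagram (opluspart la setT)) && colored B p.
Proof.
rewrite !in_diagram_heights; have [cB|ncB] := boolP (colored B p); last first.
  by rewrite /squeeze (negbTE ncB) /= andbF.
(* Because of [p.1.-1], column 0 inherits the color of column 1; it is squeezed to column 0, outside
   every diagram. *)
rewrite andbT; have [p1|] := posnP p.1; first by rewrite /squeeze cB p1 take0.
by move=> p1; have [-> ->] := heights_squeeze cB p1.
Qed.

(** The count up to a column colored in [B] includes that column, hence exceeds the count up to any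
    earlier one. *)
Lemma squeeze_ltn B p p' : colored B p -> colored B p' ->
  ((squeeze B p).1 < (squeeze B p').1) = (p.1 < p'.1).
Proof.
have mono a b : a.1 < b.1 -> colored B a -> colored B b -> (squeeze B a).1 < (squeeze B b).1.
  move=> ab ca cb; have [lti cn] := colored_nth cb; rewrite /squeeze ca cb /=.
  move: ab lti cn; case: b.1 => //= k ab lti cn.
  have x0 : nat * 'I_r by case: (columns la) lti => // x.
  exact: (@ltn_count_take _ (fun c => c.2 \in B) x0).
move=> cp cp'; have [lt|gt|e] := ltngtP p.1 p'.1; first by rewrite mono.
  by apply/negbTE; rewrite -leqNgt ltnW // mono.
by rewrite /squeeze cp cp' e ltnn.
Qed.

Lemma squeeze_inj B p p' : colored B p -> colored B p' ->
  squeeze B p = squeeze B p' -> p = p'.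
Proof.
move=> cp cp' e; have e1 := congr1 fst e; have : p.2 = p'.2 := congr1 snd e.
have : p.1 = p'.1.
  case: (ltngtP p.1 p'.1) => //.
    by rewrite -(squeeze_ltn cp cp') e1 ltnn.
  by rewrite -(squeeze_ltn cp' cp) e1 ltnn.
by case: p {cp e e1} => ? ?; case: p' {cp'} => ? ? /= -> ->.
Qed.

Lemma squeeze_surj B p : p \in diagram (opluspart la B) ->
  exists2 p', p' \in diagram (opluspart la setT) & squeeze B p' = p.
Proof.
move=> pD; move: (pD); rewrite in_diagram_heights => /and3P[p1 p2 hp].
have ltp : p.1.-1 < count (fun c => c.2 \in B) (columns la).
  rewrite -size_filter -(size_map fst) ltnNge; apply: contraTN p2 => ?.
  by rewrite -leqNgt (leq_trans hp) // nth_default.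
have x0 : nat * 'I_r by case: (columns la) ltp => // x.
have [i [lti ci ki]] := filter_position x0 ltp.
have sq : squeeze B (i.+1, p.2) = p.
  rewrite /squeeze /colored /color /= (onth_some x0 lti) /= ci.
  rewrite (take_nth x0 lti) -cats1 count_cat /= ki ci addn1 prednK //.
  by case: (p).
exists (i.+1, p.2) => //; have := squeeze_in_diagram B (i.+1, p.2).
by rewrite sq pD => /esym/andP[].
Qed.

End Columns.

(** * Splitting fillings by color *)

Section ColorClasses.
Local Open Scope nat_scope.
Variables (r : nat) (la : 'I_r -> seq nat).
Hypothesis hla : forall b, is_partition (la b).
Local Notation Z := (diagram (opluspart la setT)).
Implicit Types (B : {set 'I_r}) (f : {ffun Z -> nat}) (p : nat * nat) (z : Z).

Definition zentry f p : nat := oapp f 0 (insub p).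

Definition color_class B : {set Z} := [set z | colored la B (val z)].

Lemma expand_subproof B (b : diagram (opluspart la B)) :
  exists z, squeeze la B (val z) == val b.
Proof.
have [p pD sp] := squeeze_surj hla (valP b).
by exists [` pD]%fset; rewrite -sp.
Qed.

Definition expand B (b : diagram (opluspart la B)) : Z := xchoose (expand_subproof b).

Lemma expandK B (b : diagram (opluspart la B)) : squeeze la B (val (expand b)) = val b.
Proof. by apply/eqP/(xchooseP (expand_subproof b)). Qed.

Lemma expand_colored B (b : diagram (opluspart la B)) : colored la B (val (expand b)).
Proof.
by have := squeeze_in_diagram hla B (val (expand b)); rewrite expandK (valP b) => /esym/andP[].
Qed.

Lemma expand_inj B : injective (@expand B).
Proof. by move=> b b' e; apply: val_inj; rewrite -(expandK b) -(expandK b') e. Qed.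

Lemma expand_imset B : @expand B @: setT = color_class B.
Proof.
apply/setP => z; rewrite inE; apply/imsetP/idP => [[b _ ->]|cz].
  exact: expand_colored.
have zD : squeeze la B (val z) \in diagram (opluspart la B).
  by rewrite squeeze_in_diagram // (valP z).
exists [` zD]%fset => //; apply: val_inj.
apply: (squeeze_inj cz (expand_colored _)); by rewrite expandK.
Qed.

Lemma big_color_class (R : Type) (idx : R) (op : Monoid.com_law idx) B (F : Z -> R) :
  \big[op/idx]_(z in color_class B) F z =
  \big[op/idx]_(b : diagram (opluspart la B)) F (expand b).
Proof.
rewrite -expand_imset big_imset /=; last by move=> ? ? _ _; apply: expand_inj.
by apply: eq_bigl => b; rewrite inE.
Qed.

(** Boxes of other colors are squeezed to column 0, where [entry] is 0, so this is extension by
    0. *)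
Definition spread B (s : filling (opluspart la B)) : {ffun Z -> nat} :=
  [ffun z => entry s (squeeze la B (val z))].

Lemma entry_out B (s : filling (opluspart la B)) p :
  p \notin diagram (opluspart la B) -> entry s p = 0.
Proof. by move=> pD; rewrite /entry insubN. Qed.

Lemma entry_val B (s : filling (opluspart la B)) b : entry s (val b) = val (s b).
Proof. by rewrite /entry valK. Qed.

Lemma zentry_spread B (s : filling (opluspart la B)) p :
  zentry (spread s) p = entry s (squeeze la B p).
Proof.
rewrite /zentry; case: insubP => [z pD <-|pD] /=; first by rewrite ffunE.
by rewrite entry_out // squeeze_in_diagram // (negbTE pD).
Qed.

Lemma spread_gt0 B (s : filling (opluspart la B)) z :
  (0 < spread s z) = (z \in color_class B).
Proof.
rewrite ffunE inE; have [cz|ncz] := boolP (colored la B (val z)).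
  have zD : squeeze la B (val z) \in diagram (opluspart la B).
    by rewrite squeeze_in_diagram // (valP z).
  by rewrite (_ : squeeze _ _ _ = val [` zD]%fset) // entry_val (valP (s _)).
by rewrite entry_out // squeeze_in_diagram // (negbTE ncz) andbF.
Qed.

Lemma xmon_spread B (s : filling (opluspart la B)) : xmon s = positive_values (spread s).
Proof.
apply/msetP => k; rewrite positive_valuesE mset_seqE count_map -sum1_count big_mkcond.
rewrite big_enum_cond /= (bigID (fun z => z \in color_class B)) /= [X in _ = _ + X]big1.
  rewrite addn0 big_color_class; apply: eq_bigr => b _.
  by rewrite ffunE expandK entry_val val_eqE; case: (_ == _).
move=> z; rewrite -(spread_gt0 s) -eqn0Ngt => /eqP ->.
by case: (k) => -[].
Qed.

Lemma filling_sum_supported (K : comNzRingType) B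
    (c : filling (opluspart la B) -> K) (c' : {ffun Z -> nat} -> K) :
  (forall s, c s = c' (spread s)) ->
  filling_sum c =1 supported_sum (color_class B) c'.
Proof.
move=> cc' m; rewrite /filling_sum /supported_sum.
(* The inverse of [spread]; the value 1 stands in where [f] vanishes, which a function supported on
   the class of [B] never does on these boxes. *)
pose gather f : filling (opluspart la B) :=
  [ffun b => insubd (exist (fun n => 0 < n) 1 isT) (f (expand b))].
have spreadK s : gather (spread s) = s.
  apply/ffunP => b; rewrite ffunE; apply: val_inj.
  rewrite insubdK ffunE expandK entry_val //; exact: valP.
have gatherK f : (forall z, (0 < f z) = (z \in color_class B)) -> spread (gather f) = f.
  move=> sf; apply/ffunP => z; have [cz|ncz] := boolP (z \in color_class B).
    move: (cz); rewrite -expand_imset => /imsetP[b _ ->].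
    have fb : 0 < f (expand b) by rewrite sf inE expand_colored.
    by rewrite ffunE expandK entry_val ffunE; apply: insubdK.
  have f0 : f z = 0 by move: (ncz); rewrite -sf; case: (f z).
  by apply/eqP; rewrite f0 -leqn0 leqNgt spread_gt0.
apply: (big_seq_bij _ (h := @spread B) (h' := gather)); rewrite ?fset_uniq //.
- move=> s; rewrite mem_fillings => /eqP em; split=> //.
  apply/supported_fillingsP; split; first exact: spread_gt0.
  by rewrite -xmon_spread.
- move=> f /supported_fillingsP[sf ef]; split; last exact: gatherK.
  by rewrite mem_fillings xmon_spread gatherK // ef.
Qed.

Definition zinversion f z1 z2 : bool :=
  let s1 := zentry f (val z1) in
  let s2 := zentry f (val z2) in
  let s3 := zentry f (below (val z1)) in
  [&& (val z1).2 == (val z2).2, (val z1).1 < (val z2).1 &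
      [|| s1 <= s3 < s2, s3 < s2 < s1 | s2 < s1 <= s3]].

Definition zdescent f z : nat :=
  if (1 < (val z).2) && (zentry f (below (val z)) < zentry f (val z))
  then (leg (opluspart la setT) (val z)).+1 else 0.

(** By computation: the color and the new column of a box depend on its column only. *)
Lemma squeeze_below B p : squeeze la B (below p) = below (squeeze la B p).
Proof. by []. Qed.

Lemma is_inversion_spread B (s : filling (opluspart la B)) b1 b2 :
  is_inversion s b1 b2 = zinversion (spread s) (expand b1) (expand b2).
Proof.
rewrite /is_inversion /zinversion !zentry_spread squeeze_below !expandK.
congr [&& _, _ & _]; last by rewrite -(expandK b1) -(expandK b2) squeeze_ltn ?expand_colored.
by rewrite -(expandK b1) -(expandK b2).
Qed.

Lemma inv_spread B (s : filling (opluspart la B)) :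
  Defs.inv s = \sum_(z1 in color_class B) \sum_(z2 in color_class B) zinversion (spread s) z1 z2.
Proof.
rewrite /Defs.inv /Inv -sum1_card big_mkcond big_color_class.
under [RHS]eq_bigr => b1 _ do rewrite big_color_class.
rewrite pair_bigA /=; apply: eq_bigr => -[b1 b2] _.
by rewrite inE is_inversion_spread; case: ifP.
Qed.

Lemma maj_spread B (s : filling (opluspart la B)) :
  maj s = \sum_(z in color_class B) zdescent (spread s) z.
Proof.
rewrite /maj big_color_class big_mkcond; apply: eq_bigr => b _.
have cb := expand_colored b.
have b1 : 0 < (val (expand b)).1.
  by have := valP (expand b); rewrite in_diagram_heights // => /and3P[].
rewrite inE /zdescent !zentry_spread squeeze_below expandK.
rewrite !leg_heights ?(valP b) ?(valP (expand b)) //.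
have [_ <-] := heights_squeeze cb b1.
by rewrite -(expandK b).
Qed.

End ColorClasses.

(** * Counting inversion pairs by the colors of their boxes *)

Lemma eq_set2 (T : finType) (a b c d : T) : ([set a; b] == [set c; d]) =
  (a == c) && (b == d) || (a == d) && (b == c).
Proof.
apply/eqP/idP => [/setP e|/orP[]/andP[/eqP-> /eqP->] //]; last by rewrite setUC.
move: (e a) (e b) (e c) (e d); rewrite !inE !eqxx !orbT /=.
rewrite [c == a]eq_sym [c == b]eq_sym [d == a]eq_sym [d == b]eq_sym.
by case: (a == c); case: (a == d); case: (b == c); case: (b == d).
Qed.

Section MixedSums.
Local Open Scope nat_scope.
Variables (r : nat) (la : 'I_r -> seq nat).
Hypothesis hla : forall b, is_partition (la b).
Local Notation Z := (diagram (opluspart la setT)).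
Implicit Types (B C : {set 'I_r}) (f : {ffun Z -> nat}) (p : nat * nat) (z : Z).

Lemma mem_color_class B z b : color la (val z) = Some b -> (z \in color_class la B) = (b \in B).
Proof. by rewrite inE /colored => ->. Qed.

Lemma color_some z : exists b, color la (val z) = Some b.
Proof.
have := valP z; rewrite in_diagram_heights // => /and3P[p1 p2 hp].
rewrite /color; case e: (onth _ _) => [c|]; first by exists c.2.
move/eqP: e; rewrite -[_ == _]negbK; have -> : forall o : option (nat * 'I_r), (o != None) = o by case.
rewrite onthNE => gei.
suff : (val z).2 <= 0 by rewrite leqNgt p2.
apply: leq_trans hp _; rewrite nth_default // size_map.
by apply: leq_trans gei; rewrite size_filter count_size.
Qed.

Lemma color_classT : color_class la setT = setT.
Proof. by apply/setP => z; have [b /mem_color_class->] := color_some z; rewrite !inE. Qed.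

Lemma disjoint_color_class B C : [disjoint B & C] -> [disjoint color_class la B & color_class la C].
Proof.
move=> dBC; rewrite disjoints_subset; apply/subsetP => z; have [b eb] := color_some z.
by rewrite in_setC !(mem_color_class _ eb) => /(disjointFr dBC) ->.
Qed.

Lemma cover_color_class (P : {set {set 'I_r}}) : cover P = setT ->
  \bigcup_(B in P) color_class la B = setT.
Proof.
move=> cP; apply/setP => z; rewrite !inE; have [b eb] := color_some z.
have : b \in cover P by rewrite cP inE.
by case/bigcupP => B BP bB; apply/bigcupP; exists B; rewrite ?(mem_color_class _ eb).
Qed.

Lemma sum_color_class B (F : Z -> nat) : \sum_(z in color_class la B) F z =
  \sum_(b in B) \sum_(z | color la (val z) == Some b) F z.
Proof.
rewrite (exchange_big_dep (fun z => z \in color_class la B)) /=; last first.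
  by move=> b z bB /eqP eb; rewrite (mem_color_class _ eb).
apply: eq_bigr => z; have [b eb] := color_some z; rewrite (mem_color_class _ eb) => bB.
rewrite (big_pred1 b) // => b'; rewrite /= eb.
by apply/andP/eqP => [[_ /eqP[]]|->]; rewrite ?bB.
Qed.

(** The diagonal will give the loops, and each unordered pair of colors collects both left-to-right
    orders, just as an edge of [zgraph] does. *)
Lemma sum_matrix_split B (c : 'I_r -> 'I_r -> nat) :
  \sum_(i in B) \sum_(j in B) c i j =
  \sum_(i in B) c i i + \sum_(i in B) \sum_(j in B | i < j) (c i j + c j i).
Proof.
have -> : \sum_(i in B) \sum_(j in B | i < j) (c i j + c j i) =
   \sum_(i in B) \sum_(j in B | i < j) c i j + \sum_(i in B) \sum_(j in B | j < i) c i j.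
  under eq_bigr => i _ do rewrite big_split.
  rewrite big_split /=; congr addn.
  rewrite (exchange_big_dep (mem B)) //= => [|i j _ /andP[]//].
  by apply: eq_bigr => i iB; apply: eq_bigl => j; rewrite iB.
rewrite -!big_split; apply: eq_bigr => i iB /=.
rewrite (bigD1 i) //= (bigID (fun j : 'I_r => i < j)) /=; congr (_ + (_ + _)).
  apply: eq_bigl => j; case: (j \in B) => //=.
  by case: eqVneq => [->|]; rewrite ?ltnn.
apply: eq_bigl => j; case: (j \in B) => //=.
by rewrite -leqNgt ltn_neqAle.
Qed.

Definition crossings f i j :=
  \sum_(z1 : Z | color la (val z1) == Some i) \sum_(z2 : Z | color la (val z2) == Some j)
    zinversion f z1 z2.

Definition zInv f : {set Z * Z} := [set bb | zinversion f bb.1 bb.2].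

Definition zgraph f : multigraph r := fun i j =>
  #|[set bb in zInv f |
      [set color la (val bb.1); color la (val bb.2)] == [set Some i; Some j]]|.

Lemma zgraph_sym f i j : zgraph f i j = zgraph f j i.
Proof. by rewrite /zgraph [in LHS]setUC. Qed.

Lemma zgraphE f i j : zgraph f i j =
  if i == j then crossings f i i else crossings f i j + crossings f j i.
Proof.
have cE a b : crossings f a b =
    \sum_(bb : Z * Z | (color la (val bb.1) == Some a) && (color la (val bb.2) == Some b))
      zinversion f bb.1 bb.2 by rewrite /crossings pair_big_dep.
have -> : zgraph f i j = \sum_(bb : Z * Z |
    [set color la (val bb.1); color la (val bb.2)] == [set Some i; Some j])
      zinversion f bb.1 bb.2.
  rewrite /zgraph -sum1_card big_mkcond [RHS]big_mkcond; apply: eq_bigr => bb _.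
  by rewrite !inE; case: zinversion; case: (_ == _).
rewrite !cE; under eq_bigl => bb do rewrite eq_set2.
case: eqVneq => [->|ij]; first by apply: eq_bigl => bb; rewrite orbb.
rewrite (bigID (fun bb => color la (val bb.1) == Some i)) /=; congr addn.
  apply: eq_bigl => bb; have [->|] := eqVneq (color la (val bb.1)) (Some i); last first.
    by rewrite andbF.
  have -> : (Some i == Some j) = false by apply/negbTE; apply: contra ij => /eqP[->].
  by rewrite /= orbF andbT.
apply: eq_bigl => bb; have [->|] := eqVneq (color la (val bb.1)) (Some i).
  have -> : (Some i == Some j) = false by apply/negbTE; apply: contra ij => /eqP[->].
  by rewrite andbF.
by rewrite andbT.
Qed.

Lemma sum_zinversion_class f B :
  \sum_(z1 in color_class la B) \sum_(z2 in color_class la B) zinversion f z1 z2 =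
  \sum_(b in B) zgraph f b b + inner_edges (zgraph f) B.
Proof.
transitivity (\sum_(i in B) \sum_(j in B) crossings f i j).
  rewrite sum_color_class; apply: eq_bigr => i _; rewrite exchange_big sum_color_class.
  by apply: eq_bigr => j _; rewrite exchange_big.
rewrite sum_matrix_split; congr addn.
  by apply: eq_bigr => b _; rewrite zgraphE eqxx.
apply: eq_bigr => i _; apply: eq_bigr => j /andP[_ ij]; rewrite zgraphE.
by case: eqVneq ij => // ->; rewrite ltnn.
Qed.

Lemma zentry_restrict f B p : colored la B p ->
  zentry (restrict (color_class la B) f) p = zentry f p.
Proof.
move=> cp; rewrite /zentry; case: insubP => //= z _ ez.
by move: cp; rewrite ffunE inE -ez => ->.
Qed.

Lemma squeezeT z : squeeze la setT (val z) = val z.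
Proof.
have [b eb] := color_some z; have cz : colored la setT (val z) by rewrite /colored eb /= inE.
have [lti _] := colored_nth cz; rewrite /squeeze cz (eq_count (a2 := predT)) => [|c]; last first.
  by rewrite /= inE.
rewrite count_predT size_takel; last by apply: leq_trans (leqSpred _) lti.
by case: (val z).
Qed.

Lemma Inv_spreadT (s : filling (opluspart la setT)) : Inv s = zInv (spread s).
Proof.
have eE p : entry s p = zentry (spread s) p.
  rewrite zentry_spread //; have [pD|pD] := boolP (p \in Z).
    by rewrite (squeezeT [` pD]%fset).
  by rewrite !entry_out // squeeze_in_diagram // (negbTE pD).
by apply/setP => bb; rewrite !inE /is_inversion /zinversion !eE.
Qed.

End MixedSums.

(** * Cumulants of Macdonald polynomials *)

Section Cumulants.
Variables (K : fieldType) (q t : K) (r : nat) (la : 'I_r -> seq nat).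
Hypothesis hla : forall b, is_partition (la b).
Local Notation Z := (diagram (opluspart la setT)).
Implicit Types (B : {set 'I_r}) (f : {ffun Z -> nat}) (P : {set {set 'I_r}}).

Definition class_maj B f := (\sum_(z in color_class la B) zdescent f z)%N.

Definition class_weight B f : K :=
  q ^+ (\sum_(z1 in color_class la B) \sum_(z2 in color_class la B) zinversion f z1 z2)%N *
  t ^+ class_maj B f.

Lemma Htilde_supported B :
  Htilde q t (opluspart la B) =1 supported_sum (color_class la B) (class_weight B).
Proof.
apply: filling_sum_supported => // s.
by rewrite /class_weight /class_maj inv_spread // maj_spread.
Qed.

(** The box below another one lies in the same column and has the same color, so descents and
    inversions of the class consult no entry outside it. *)
Lemma class_weight_restrict B f :
  class_weight B (restrict (color_class la B) f) = class_weight B f.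
Proof.
rewrite /class_weight; congr (q ^+ _ * t ^+ _).
  apply: eq_bigr => z1; rewrite inE => c1; apply: eq_bigr => z2; rewrite inE => c2.
  by rewrite /zinversion !zentry_restrict.
apply: eq_bigr => z; rewrite inE => c; by rewrite /zdescent !zentry_restrict.
Qed.

(** Every color lies in exactly one block, so loops and descents are counted in full for each [P]
    and factor out of the cumulant; only the inner edges depend on [P]. *)
Lemma prod_class_weight P f : partition P setT ->
  \prod_(B in P) class_weight B f =
  q ^+ loops (zgraph f) * \prod_(B in P) q ^+ inner_edges (zgraph f) B *
  t ^+ class_maj setT f.
Proof.
move=> pP; rewrite big_split /= -!expr_sum; congr (_ * t ^+ _); last first.
  rewrite /class_maj [RHS]sum_color_class // (set_partition_big _ pP) /=.
  by apply: eq_bigr => B _; rewrite sum_color_class.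
rewrite -exprD; congr (q ^+ _).
under eq_bigr => B _ do rewrite sum_zinversion_class //.
rewrite big_split /= /loops; congr addn.
rewrite -(set_partition_big _ pP) /=.
by apply: eq_bigl => b; rewrite inE.
Qed.

Lemma prod_Htilde P m : partition P setT ->
  (\big[@smul K/@sone K]_(B in P) Htilde q t (opluspart la B)) m =
  supported_sum setT (fun f => \prod_(B in P) class_weight B f) m.
Proof.
move=> pP; have /and3P[/eqP cP tP _] := pP.
rewrite -big_filter (big_smul_supported_sum (D := color_class la) (c := class_weight)).
- rewrite big_filter cover_color_class //; apply: eq_bigr => f _.
  by rewrite big_filter; apply: eq_bigr => B _; rewrite class_weight_restrict.
- by rewrite filter_uniq // index_enum_uniq.
- move=> B C; rewrite !mem_filter => /andP[BP _] /andP[CP _] BC.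
  by apply: disjoint_color_class => //; apply: (trivIsetP tP).
- exact: Htilde_supported.
Qed.

Theorem cumulant_fillings (hr : (0 < r)%N) : q != 1 ->
  cumulant q t la =1
  filling_sum (fun s : filling (opluspart la setT) =>
    Ginv_poly q (Ordinal hr) (Ggraph s) * t ^+ maj s).
Proof.
(* Colors in ['I_r] start at 0, so this is the vertex called 1 in the definition of the inversion
   polynomial. *)
move=> q1 m; pose root := Ordinal hr.
rewrite (filling_sum_supported hla
  (c' := fun f => Ginv_poly q root (zgraph f) * t ^+ class_maj setT f)); last first.
  by move=> s; rewrite /Ggraph Inv_spreadT // /class_maj -maj_spread.
rewrite color_classT // /cumulant.
under eq_bigr => P pP do rewrite prod_Htilde // /supported_sum.
transitivity ((q - 1) ^ (1 - r%:Z) * \sum_(f <- supported_fillings setT m)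
   (q ^+ loops (zgraph f) * set_cumulant (fun B => q ^+ inner_edges (zgraph f) B) setT *
    t ^+ class_maj setT f)).
  congr (_ * _); under eq_bigr => P pP do rewrite big_distrr /=.
  rewrite exchange_big /=; apply: eq_bigr => f _.
  rewrite /set_cumulant big_distrr big_distrl /=; apply: eq_bigr => P pP.
  by rewrite prod_class_weight // /cumulant_coef !mulrA [_ * q ^+ loops _]mulrC !mulrA.
rewrite big_distrr /=; apply: eq_bigr => f _; rewrite mulrA; congr (_ * _).
have zs := zgraph_sym f.
rewrite -(tree_sumE _ zs (in_setT root)) -Ginv_poly_tree_sum //.
(* As [r] is positive, the integer exponent 1 - r is the negative of [r.-1]; the power of q - 1 from
   the trees then cancels, q - 1 being invertible. *)
have -> : 1 - r%:Z = - r.-1%:Z :> int by rewrite -{1}(prednK hr) intS opprD addrA subrr add0r.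
by rewrite -exprnN mulrA mulVf ?mul1r // expf_neq0 // subr_eq0.
Qed.

End Cumulants.

Lemma qvar_neq1 : qvar != 1.
Proof.
(* The constant coefficients, 0 and 1, differ. *)
rewrite /qvar -tofrac1 tofrac_eq; apply/eqP => /(congr1 (mcoeff 0%MM)).
rewrite mcoeffX mcoeff1 eqxx mnm1_eq0 => /eqP.
by rewrite eq_sym oner_eq0.
Qed.

Theorem theorem1p4 (r : nat) (hr : (0 < r)%N) (la : 'I_r -> seq nat)
  (hla : forall b : 'I_r, is_partition (la b)) :
  cumulant qvar tvar la =1
  filling_sum (fun s : filling (opluspart la [set: 'I_r]) =>
    Ginv_poly qvar (Ordinal hr) (Ggraph s) * tvar ^+ maj s).
Proof. exact: cumulant_fillings qvar_neq1. Qed.
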